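(* Let $(C,\bigtriangleup,\sigma)$ be a braided coalgebra. Let $\phi:C\to T(C)\underline{\otimes}T(C)$ be the linear map $$\phi(c)=1\underline{\otimes}c+c\underline{\otimes}1+\sum_{(c)}c_{(1)}\underline{\otimes}c_{(2)},$$ and let $\Phi:T(C)\to \mathscr{T}^2_\beta(C)$ be the unique (unital) algebra map from the tensor algebra $T(C)$ extending $\phi$. Then $(T(C),\Phi,\beta)$ is a braided coalgebra.
   Context: Everything is over a field $\mathbb{K}$ of characteristic $0$. A braiding on a vector space $V$ is an invertible linear map $\sigma\in\mathrm{End}(V\otimes V)$ with $(\sigma\otimes \mathrm{id})(\mathrm{id}\otimes \sigma)(\sigma\otimes \mathrm{id})=(\mathrm{id}\otimes \sigma)(\sigma\otimes \mathrm{id})(\mathrm{id}\otimes \sigma)$ on $V^{\otimes 3}$. Write $\sigma_k=\mathrm{id}_V^{\otimes k-1}\otimes\sigma\otimes\mathrm{id}_V^{\otimes n-k-1}$ on $V^{\otimes n}$. A braided coalgebra $(C,\bigtriangleup,\sigma)$ is a coalgebra $C$ with (coassociative) coproduct $\bigtriangleup$ and counit $\varepsilon$, together with a braiding $\sigma$ on $C$, such that $(\mathrm{id}_C\otimes\bigtriangleup)\sigma=\sigma_1\sigma_2(\bigtriangleup\otimes\mathrm{id}_C)$ and $(\bigtriangleup\otimes\mathrm{id}_C)\sigma=\sigma_2\sigma_1(\mathrm{id}_C\otimes\bigtriangleup)$. Sweedler notation: $\bigtriangleup(c)=\sum_{(c)}c_{(1)}\otimes c_{(2)}$. $T(C)=\bigoplus_{n\ge0}C^{\otimes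 n}$ is the tensor algebra with concatenation product $m$ and $C^{\otimes0}=\mathbb{K}$; $\underline{\otimes}$ denotes the tensor product between copies of $T(C)$, to distinguish it from $\otimes$ inside $T(C)$. For $w\in\mathfrak{S}_n$ with reduced expression $w=s_{k_1}\cdots s_{k_l}$ in the generators $s_k=(k\ k{+}1)$ (products are composition of maps, the right factor acting first), $T^\sigma_w=\sigma_{k_1}\cdots\sigma_{k_l}$ on $C^{\otimes n}$ (independent of the reduced expression). For $i,j\ge1$, $\chi_{ij}\in\mathfrak{S}_{i+j}$ is given by $\chi_{ij}(r)=j+r$ for $1\le r\le i$ and $\chi_{ij}(i+r)=r$ for $1\le r\le j$. The map $\beta:T(C)\underline{\otimes}T(C)\to T(C)\underline{\otimes}T(C)$ is defined by $\beta|_{C^{\otimes i}\underline{\otimes}C^{\otimes j}}=\beta_{ij}=T^\sigma_{\chi_{ij}}$ (with values in $C^{\otimes j}\underline{\otimes}C^{\otimes i}$) for $i,j\ge1$, and $\beta_{0i},\beta_{i0}$ are the identity map of $C^{\otimes i}$ (i.e. $1\underline{\otimes}x\leftrightarrow x\underline{\otimes}1$). It is a braiding on $T(C)$, and $(T(C),m,\beta)$ is compatible in the sense of braided algebras. $\mathscr{T}^2_\beta(C)$ is the associative algebra $T(C)\underline{\otimes}T(C)$ with product $m_{\beta,2}=(m\otimes m)(\mathrm{id}_{T(C)}\otimes\beta\otimes\mathrm{id}_{T(C)})$ and unit $1\underline{\otimes}1$. *)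

(* Defs.v *)
From HB Require Import structures.
From mathcomp Require Import all_boot all_algebra perm.
From mathcomp Require Import boolp classical_sets finmap.
From mathcomp Require Import monalg.
From mathcomp Require Import zify.

Set Implicit Arguments.
Unset Strict Implicit.
Unset Printing Implicit Defensive.

Import GRing.Theory.
Local Open Scope ring_scope.

Reserved Notation "U ⊗ V" (at level 40, left associativity).
Reserved Notation "u \ox v" (at level 40, left associativity).

(* The K-vector space presented by the generators G and the relators R:      *)
(* the free vector space {malg K[G]} modulo the span of R.                   *)
Section Presentation.
Variables (K : fieldType) (G : choiceType) (R : {malg K[G]} -> Prop).

Definition relspan : {pred {malg K[G]}} := fun x =>
  `[< exists2 s : seq (K * {malg K[G]}),
        forall p, p \in s -> R p.2 & x = \sum_(p <- s) p.1 *: p.2 >].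

Lemma relspan_submod : submod_closed relspan.
Proof.
split; first by apply/asboolP; exists [::]; rewrite ?big_nil.
move=> a x y /asboolP[s Rs ->] /asboolP[t Rt ->]; apply/asboolP.
exists ([seq (a * p.1, p.2) | p <- s] ++ t).
  by move=> p; rewrite mem_cat => /orP[/mapP[q /Rs + ->]|/Rt].
rewrite big_cat big_map scaler_sumr /=; congr (_ + _).
by apply: eq_bigr => p _; rewrite scalerA.
Qed.

HB.instance Definition _ :=
  GRing.isSubmodClosed.Build K {malg K[G]} relspan relspan_submod.

Lemma relspan_rel x : R x -> x \in relspan.
Proof.
move=> Rx; apply/asboolP; exists [:: (1, x)]; last first.
  by rewrite big_seq1 scale1r.
by move=> p; rewrite inE => /eqP ->.
Qed.

Definition presented := Quotient.quot relspan.
HB.instance Definition _ := GRing.Zmodule.on presented.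

End Presentation.

HB.lock Definition pcls (K : fieldType) (G : choiceType)
  (R : {malg K[G]} -> Prop) (x : {malg K[G]}) : presented R :=
  (\pi_(presented R) x)%qT.

Section PresentedLmodule.
Variables (K : fieldType) (G : choiceType) (R : {malg K[G]} -> Prop).
Local Notation presented := (presented R).
Local Notation pcls := (pcls R).

Lemma pclsE x y : (pcls x = pcls y) <-> (x - y \in relspan R).
Proof. by rewrite unlock Quotient.idealrBE; split=> /eqP. Qed.

Lemma pclsD x y : pcls (x + y) = pcls x + pcls y.
Proof. by rewrite unlock [LHS]raddfD. Qed.

Lemma pcls_repr q : pcls (repr q) = q.
Proof. by rewrite unlock; exact: reprK. Qed.

Definition pscale (a : K) (q : presented) : presented := pcls (a *: repr q).

Lemma pclsZ a x : pcls (a *: x) = pscale a (pcls x).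
Proof. by apply/pclsE; rewrite -scalerBr rpredZ //; apply/pclsE; rewrite pcls_repr. Qed.

Fact pscaleA a b q : pscale a (pscale b q) = pscale (a * b) q.
Proof. by rewrite -(pcls_repr q) -!pclsZ scalerA. Qed.
Fact pscale1 : left_id 1 pscale.
Proof. by move=> q; rewrite -(pcls_repr q) -!pclsZ scale1r. Qed.
Fact pscaleDr : right_distributive pscale +%R.
Proof.
move=> a q r; rewrite -(pcls_repr q) -(pcls_repr r) -pclsD -!pclsZ.
by rewrite scalerDr pclsD.
Qed.
Fact pscaleDl q : {morph pscale^~ q : a b / a + b}.
Proof.
by move=> a b; rewrite -(pcls_repr q) -!pclsZ scalerDl pclsD.
Qed.
HB.instance Definition _ := GRing.Zmodule_isLmodule.Build K presented
  pscaleA pscale1 pscaleDr pscaleDl.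

Fact pcls_linear : linear pcls.
Proof. by move=> a x y; rewrite pclsD pclsZ. Qed.
HB.instance Definition _ :=
  GRing.isLinear.Build K {malg K[G]} presented _ pcls pcls_linear.

End PresentedLmodule.

HB.lock Definition pgen (K : fieldType) (G : choiceType)
  (R : {malg K[G]} -> Prop) (g : G) : presented R := pcls R << g >>.

Lemma pgenE (K : fieldType) (G : choiceType) (R : {malg K[G]} -> Prop) (g : G) :
  pgen R g = pcls R << g >>.
Proof. by rewrite unlock. Qed.

Section FreeExt.
Variables (K : fieldType) (G : choiceType).
Variables (W : lmodType K) (f : G -> W).

Definition free_ext (x : {malg K[G]}) : W := \sum_(g <- msupp x) x@_g *: f g.

Fact free_ext_linear : linear free_ext.
Proof.
have extE (d : {fset G}) x : (msupp x `<=` d)%fset ->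
    free_ext x = \sum_(g <- d) x@_g *: f g.
  move=> le; rewrite [LHS](big_fset_incl _ le) => //= g gd /mcoeff_outdom ->.
  by rewrite scale0r.
move=> a x y; pose d := (msupp x `|` msupp y)%fset.
rewrite (extE d x) ?fsubsetUl // (extE d y) ?fsubsetUr // (extE d); last first.
  rewrite (fsubset_trans (msuppD_le _ _)) // fsetSU //; exact: msuppZ_le.
rewrite scaler_sumr -big_split; apply: eq_bigr => g _ /=.
by rewrite mcoeffD mcoeffZ scalerDl scalerA.
Qed.
HB.instance Definition _ :=
  GRing.isLinear.Build K {malg K[G]} W _ free_ext free_ext_linear.

Lemma free_extU g : free_ext << g >> = f g.
Proof. by rewrite /free_ext msuppU oner_eq0 big_seq_fset1 mcoeffUU scale1r. Qed.

End FreeExt.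

(* If f does not respect the relators, there is no map to be defined and     *)
(* presented_lift f is 0 by convention.                                      *)
HB.lock Definition presented_lift (K : fieldType) (G : choiceType)
    (R : {malg K[G]} -> Prop) (W : lmodType K) (f : G -> W)
    (q : presented R) : W :=
  if `[< forall x, R x -> free_ext f x = 0 >] then free_ext f (repr q) else 0.

Section LiftTheory.
Variables (K : fieldType) (G : choiceType) (R : {malg K[G]} -> Prop).
Local Notation presented := (presented R).

Section Lift.
Variables (W : lmodType K) (f : G -> W).
Local Notation presented_lift := (@presented_lift K G R W f).
Local Notation free_ext := (free_ext f).

Fact presented_lift_linear : linear presented_lift.
Proof.
rewrite unlock => a q r; case: asboolP => [fR|_]; last first.
  by rewrite scaler0 addr0.
rewrite -linearP; apply/eqP; rewrite -subr_eq0 -linearB.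
have /asboolP[s sR ->] : repr (a *: q + r) - (a *: repr q + repr r) \in relspan R.
  by apply/pclsE; rewrite linearP /= !pcls_repr.
rewrite linear_sum big_seq big1 // => p ps.
by rewrite linearZ_LR /= fR ?scaler0 //; apply: sR.
Qed.
HB.instance Definition _ :=
  GRing.isLinear.Build K presented W _ presented_lift presented_lift_linear.

Lemma presented_liftE :
    (forall x, R x -> free_ext x = 0) -> forall g, presented_lift (pgen R g) = f g.
Proof.
move=> fR g; rewrite presented_lift.unlock asboolT // -(free_extU f).
apply/eqP; rewrite -subr_eq0 -linearB.
have /asboolP[s sR ->] : repr (pgen R g) - << g >> \in relspan R.
  by apply/pclsE; rewrite pcls_repr pgenE.
rewrite linear_sum big_seq big1 // => p ps.
by rewrite linearZ_LR /= fR ?scaler0 //; apply: sR.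
Qed.

End Lift.

Lemma presented_ext (W : lmodType K) (f h : {linear presented -> W}) :
  (forall g, f (pgen R g) = h (pgen R g)) -> f =1 h.
Proof.
move=> fh q; rewrite -(pcls_repr q) [repr q]monalgE !linear_sum /=.
apply: eq_bigr => g _.
have -> : << (repr q)@_g *g g >> = (repr q)@_g *: << g >> :> {malg K[G]}.
  apply/malgP => k; rewrite mcoeffZ !mcoeffU.
  by case: eqP; rewrite ?mulr1 ?mulr0.
by rewrite !linearZ /= -pgenE fh.
Qed.

Lemma pcls_rel x : R x -> pcls R x = 0.
Proof. by move=> Rx; rewrite -(linear0 (pcls R)); apply/pclsE; rewrite subr0 relspan_rel. Qed.

End LiftTheory.

Definition bilinear_map (K : fieldType) (U V W : lmodType K) (f : U -> V -> W) :=
  (forall v, linear (f^~ v)) /\ (forall u, linear (f u)).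

Section Tensor.
Variables (K : fieldType) (U V : lmodType K).

Variant tensor_rel : {malg K[(U * V)%type]} -> Prop :=
| TensorRelL a u u' v :
    tensor_rel (<< (a *: u + u', v) >> - (a *: << (u, v) >> + << (u', v) >>))
| TensorRelR u a v v' :
    tensor_rel (<< (u, a *: v + v') >> - (a *: << (u, v) >> + << (u, v') >>)).

Definition tensor := presented tensor_rel.
HB.instance Definition _ := GRing.Lmodule.on tensor.

Definition pure (u : U) (v : V) : tensor := pgen tensor_rel (u, v).

Lemma pure_bilinear : bilinear_map pure.
Proof.
split=> [v a u u'|u a v v'].
  by have := pcls_rel (TensorRelL a u u' v); rewrite linearB linearP /pure !pgenE => /subr0_eq.
by have := pcls_rel (TensorRelR u a v v'); rewrite linearB linearP /pure !pgenE => /subr0_eq.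
Qed.

Lemma purePl v a u u' : pure (a *: u + u') v = a *: pure u v + pure u' v.
Proof. exact: pure_bilinear.1. Qed.

Lemma purePr u a v v' : pure u (a *: v + v') = a *: pure u v + pure u v'.
Proof. exact: pure_bilinear.2. Qed.

HB.instance Definition _ u :=
  GRing.isLinear.Build K V tensor _ (pure u) (purePr u).

Definition purer v u := pure u v.
HB.instance Definition _ v :=
  GRing.isLinear.Build K U tensor _ (purer v) (purePl v).

Section TensorLift.
Variables (W : lmodType K) (f : U -> V -> W).

Definition tensor_lift : tensor -> W :=
  presented_lift (R := tensor_rel) (fun p => f p.1 p.2).
HB.instance Definition _ := GRing.Linear.on tensor_lift.

Lemma tensor_liftE : bilinear_map f -> forall u v, tensor_lift (pure u v) = f u v.
Proof.
move=> [fl fr] u v; apply: (@presented_liftE _ _ _ _ _ _ (u, v)) => x.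
case=> [a {}u u' {}v|{}u a {}v v']; rewrite linearB linearP /= !free_extU /=.
  by rewrite (fl v) subrr.
by rewrite (fr u) subrr.
Qed.
End TensorLift.

Lemma tensor_ext (W : lmodType K) (f h : {linear tensor -> W}) :
  (forall u v, f (pure u v) = h (pure u v)) -> f =1 h.
Proof. by move=> fh; apply: presented_ext => -[u v]; exact: fh. Qed.

End Tensor.

Arguments tensor {K} (U V)%_type_scope.
Notation "U ⊗ V" := (tensor U V).
Notation "u \ox v" := (pure u v) : ring_scope.

Section TensorMaps.
Variables (K : fieldType).
Implicit Types U V W : lmodType K.

Definition tensor_map U U' V V'
    (f : {linear U -> U'}) (g : {linear V -> V'}) : U ⊗ V -> U' ⊗ V' :=
  tensor_lift (fun u v => f u \ox g v).
HB.instance Definition _ U U' V V' f g :=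
  GRing.Linear.on (@tensor_map U U' V V' f g).

Lemma tensor_mapE U U' V V' (f : {linear U -> U'}) (g : {linear V -> V'}) u v :
  tensor_map f g (u \ox v) = f u \ox g v.
Proof.
rewrite /tensor_map tensor_liftE //; split=> [{}v a x y|{}u a x y] /=.
  by rewrite linearP purePl.
by rewrite linearP purePr.
Qed.

Definition assoc U V W : (U ⊗ V) ⊗ W -> U ⊗ (V ⊗ W) :=
  tensor_lift (fun t w => tensor_lift (fun u v => u \ox (v \ox w)) t).
HB.instance Definition _ U V W := GRing.Linear.on (@assoc U V W).

Definition assocV U V W : U ⊗ (V ⊗ W) -> (U ⊗ V) ⊗ W :=
  tensor_lift (fun u t => tensor_lift (fun v w => (u \ox v) \ox w) t).
HB.instance Definition _ U V W := GRing.Linear.on (@assocV U V W).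

Lemma assocE U V W (u : U) (v : V) (w : W) :
  assoc ((u \ox v) \ox w) = u \ox (v \ox w).
Proof.
have inE (w' : W) : bilinear_map (fun (u : U) (v : V) => u \ox (v \ox w')).
  split=> [{}v a x y|{}u a x y]; first by rewrite purePl.
  by rewrite purePl purePr.
rewrite /assoc tensor_liftE ?tensor_liftE //.
split=> [{u v}w' | t a x y]; first exact: linearP.
apply: (tensor_ext (h := (a \*: tensor_lift (fun u v => u \ox (v \ox x))) \+
  tensor_lift (fun u v => u \ox (v \ox y)))) => {}u {}v /=.
by rewrite !tensor_liftE // !purePr.
Qed.

Lemma assocVE U V W (u : U) (v : V) (w : W) :
  assocV (u \ox (v \ox w)) = (u \ox v) \ox w.
Proof.
have inE (u' : U) : bilinear_map (fun (v : V) (w : W) => (u' \ox v) \ox w).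
  split=> [{}w a x y|{}v a x y]; last by rewrite purePr.
  by rewrite purePr purePl.
rewrite /assocV tensor_liftE ?tensor_liftE //.
split=> [t a x y | {v w}u']; last exact: linearP.
apply: (tensor_ext (h := (a \*: tensor_lift (fun v w => (x \ox v) \ox w)) \+
  tensor_lift (fun v w => (y \ox v) \ox w))) => {}v {}w /=.
by rewrite !tensor_liftE // !purePl.
Qed.

End TensorMaps.

Section TensorAlgebra.
Variables (K : fieldType) (C : lmodType K).

(* The tensor algebra T(C) is spanned by the words c_1 ... c_n, that is the   *)
(* pure tensors of C^{(x) n}, subject to multilinearity in the letters; the   *)
(* relators are homogeneous, so the words of length n span the summand       *)
(* C^{(x) n}, and the empty word spans C^{(x) 0} = K.                         *)
Variant tensor_algebra_rel : {malg K[seq C]} -> Prop :=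
| TensorAlgebraRel p a c c' s :
    tensor_algebra_rel (<< p ++ (a *: c + c') :: s >>
                        - (a *: << p ++ c :: s >> + << p ++ c' :: s >>)).

Definition tensor_algebra := presented tensor_algebra_rel.
HB.instance Definition _ := GRing.Lmodule.on tensor_algebra.

Definition word (w : seq C) : tensor_algebra := pgen tensor_algebra_rel w.

Definition multilinear (W : lmodType K) (f : seq C -> W) := forall p a c c' s,
  f (p ++ (a *: c + c') :: s) = a *: f (p ++ c :: s) + f (p ++ c' :: s).

Lemma word_multilinear : multilinear word.
Proof.
move=> p a c c' s; have := pcls_rel (TensorAlgebraRel p a c c' s).
by rewrite linearB linearP /word !pgenE => /subr0_eq.
Qed.

Definition word_lift (W : lmodType K) (f : seq C -> W) : tensor_algebra -> W :=
  presented_lift (R := tensor_algebra_rel) f.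
HB.instance Definition _ W f := GRing.Linear.on (@word_lift W f).

Lemma word_liftE (W : lmodType K) (f : seq C -> W) :
  multilinear f -> forall w, word_lift f (word w) = f w.
Proof.
move=> fM; apply: presented_liftE => _ [p a c c' s].
by rewrite linearB linearP /= !free_extU fM subrr.
Qed.

Lemma word_ext (W : lmodType K) (f h : {linear tensor_algebra -> W}) :
  (forall w, f (word w) = h (word w)) -> f =1 h.
Proof. exact: presented_ext. Qed.

Lemma word2_ext (W : lmodType K)
    (f h : {linear tensor_algebra ⊗ tensor_algebra -> W}) :
  (forall u v, f (word u \ox word v) = h (word u \ox word v)) -> f =1 h.
Proof.
move=> fh; apply: tensor_ext => x y.
apply: (word_ext (f := f \o purer y) (h := h \o purer y)) => u /=.
by apply: (word_ext (f := f \o pure (word u)) (h := h \o pure (word u))) => v /=.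
Qed.

Definition word_lift2 (W : lmodType K) (f : seq C -> seq C -> W) :
    tensor_algebra ⊗ tensor_algebra -> W :=
  tensor_lift (fun x y => word_lift (fun u => word_lift (f u) y) x).
HB.instance Definition _ W f := GRing.Linear.on (@word_lift2 W f).

Lemma word_lift2E (W : lmodType K) (f : seq C -> seq C -> W) :
    (forall v, multilinear (f^~ v)) -> (forall u, multilinear (f u)) ->
  forall u v, word_lift2 f (word u \ox word v) = f u v.
Proof.
move=> fMl fMr u v.
have fM y : multilinear (fun u => word_lift (f u) y).
  move=> p a c c' s.
  apply: (word_ext (h := (a \*: word_lift (f (p ++ c :: s)))
                         \+ word_lift (f (p ++ c' :: s)))) => w /=.
  by rewrite !word_liftE // (fMl w).
rewrite /word_lift2 tensor_liftE ?word_liftE //.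
split=> [y|x a y y']; first exact: linearP.
apply: (word_ext (h := (a \*: word_lift (fun u => word_lift (f u) y))
                       \+ word_lift (fun u => word_lift (f u) y'))) => w /=.
by rewrite !word_liftE // linearP.
Qed.

Definition letter (c : C) : tensor_algebra := word [:: c].

Fact letter_linear : linear letter.
Proof. by move=> a c c'; exact: (word_multilinear [::] a c c' [::]). Qed.
HB.instance Definition _ :=
  GRing.isLinear.Build K C tensor_algebra _ letter letter_linear.

Definition word2 : C ⊗ C -> tensor_algebra :=
  tensor_lift (fun c d => word [:: c; d]).
HB.instance Definition _ := GRing.Linear.on word2.

Lemma word2E c d : word2 (c \ox d) = word [:: c; d].
Proof.
rewrite /word2 tensor_liftE //; split=> [{}d a x y|{}c a x y].
  exact: (word_multilinear [::] a x y [:: d]).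
exact: (word_multilinear [:: c] a x y [::]).
Qed.

Definition concat : tensor_algebra ⊗ tensor_algebra -> tensor_algebra :=
  word_lift2 (fun u v => word (u ++ v)).
HB.instance Definition _ := GRing.Linear.on concat.

Lemma concatE u v : concat (word u \ox word v) = word (u ++ v).
Proof.
rewrite /concat word_lift2E // => {u v} [v|u] p a c c' s.
  by rewrite -!catA word_multilinear.
by rewrite !catA word_multilinear.
Qed.

Definition deconcat (j : nat) :
    tensor_algebra -> tensor_algebra ⊗ tensor_algebra :=
  word_lift (fun w => word (take j w) \ox word (drop j w)).
HB.instance Definition _ j := GRing.Linear.on (deconcat j).

Lemma deconcatE j w : deconcat j (word w) = word (take j w) \ox word (drop j w).
Proof.
rewrite /deconcat word_liftE // => {w} p a c c' s.
rewrite !take_cat !drop_cat; case: ltnP => [_|lepj].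
  by rewrite word_multilinear purePr.
case: (j - size p)%N => [|i] /=.
  by rewrite -[a *: c + c' :: s]cat0s word_multilinear purePr.
by rewrite word_multilinear purePl.
Qed.

(* sigma_k on words, with the letters numbered from 0: sigma acts on the     *)
(* letters k and k.+1; words which are too short are left unchanged.         *)
Section BraidAt.
Variable sigma : {linear C ⊗ C -> C ⊗ C}.

Definition braid_word (k : nat) (w : seq C) : tensor_algebra :=
  if (k.+1 < size w)%N then
    concat (concat (word (take k w)
                    \ox word2 (sigma (nth 0 w k \ox nth 0 w k.+1)))
            \ox word (drop k.+2 w))
  else word w.

Definition braid_at (k : nat) : tensor_algebra -> tensor_algebra :=
  word_lift (braid_word k).
HB.instance Definition _ k := GRing.Linear.on (braid_at k).

Lemma braid_word_cat p c d s :
  braid_word (size p) (p ++ [:: c, d & s]) =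
  concat (concat (word p \ox word2 (sigma (c \ox d))) \ox word s).
Proof.
rewrite /braid_word size_cat /= !addnS !ltnS leq_addr take_size_cat // nth_cat.
rewrite ltnn subnn nth_cat ltnNge leqnSn subSn // subnn /=.
by rewrite -[(size p).+2]add2n -drop_drop drop_size_cat //= drop0.
Qed.

Fact braid_word_cat_linear p s : linear (fun t =>
  concat (concat (word p \ox word2 (sigma t)) \ox word s)).
Proof.
exact: (linearP (concat \o purer (word s) \o concat \o pure (word p)
  \o word2 \o sigma)).
Qed.

Lemma braid_word_multilinear k : multilinear (braid_word k).
Proof.
move=> p a c c' s.
have [ltk|lek] := ltnP k.+1 (size p + (size s).+1); last first.
  by rewrite /braid_word !size_cat /= ltnNge lek /= word_multilinear.
have [lt1|le1] := ltnP k.+1 (size p).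
  have [p1 [d [e [p2 [<- ->]]]]] : exists p1 d e p2,
      size p1 = k /\ p = p1 ++ [:: d, e & p2].
    exists (take k p), (nth 0 p k), (nth 0 p k.+1), (drop k.+2 p).
    rewrite size_takel; last by rewrite ltnW // ltnW.
    by rewrite -!drop_nth ?cat_take_drop // ltnW.
  by rewrite -!catA !braid_word_cat -!/(cat _ _) word_multilinear purePr linearP.
have [eq1|lt1] := leqP (size p) k; last first.
  have [p1 [d [<- ->]]] : exists p1 d, size p1 = k /\ p = rcons p1 d.
    case/lastP: p le1 lt1 {ltk} => // p1 d; rewrite size_rcons !ltnS => le1 le2.
    by exists p1, d; split=> //; apply/eqP; rewrite eqn_leq le1 le2.
  by rewrite !cat_rcons !braid_word_cat purePr braid_word_cat_linear.
move: eq1; rewrite leq_eqVlt => /orP[/eqP eqk|gtk].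
  case: s ltk => [|d s _]; first by rewrite -eqk addn1 ltnn.
  by rewrite -eqk !braid_word_cat purePl braid_word_cat_linear.
have [s1 [d [e [s2 [sz ->]]]]] : exists s1 d e s2,
    (size p + (size s1).+1 = k)%N /\ s = s1 ++ [:: d, e & s2].
  have lt2 : ((k - (size p).+1).+1 < size s)%N by lia.
  exists (take (k - (size p).+1) s), (nth 0 s (k - (size p).+1)),
    (nth 0 s (k - (size p).+1).+1), (drop (k - (size p).+1).+2 s).
  rewrite size_takel; last by lia.
  rewrite -!drop_nth ?cat_take_drop //; last by lia.
  by split=> //; lia.
have szE x : k = size (p ++ x :: s1) by rewrite size_cat.
rewrite -!cat_cons !catA {1}(szE (a *: c + c')) {1}(szE c) (szE c').
by rewrite !braid_word_cat word_multilinear purePl linearP purePl linearP.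
Qed.

Lemma braid_atE p c d s :
  braid_at (size p) (word (p ++ [:: c, d & s])) =
  concat (concat (word p \ox word2 (sigma (c \ox d))) \ox word s).
Proof.
by rewrite /braid_at word_liftE ?braid_word_cat //; apply: braid_word_multilinear.
Qed.
End BraidAt.
End TensorAlgebra.

Section ReducedExpressions.
Variable n : nat.

Lemma ord_pred_lt (k : 'I_n.-1) : (k < n)%N. Proof. case: k => /= k; lia. Qed.
Lemma ord_pred_ltS (k : 'I_n.-1) : (k.+1 < n)%N. Proof. case: k => /= k; lia. Qed.

Definition adj_transp (k : 'I_n.-1) : 'S_n :=
  tperm (Ordinal (ord_pred_lt k)) (Ordinal (ord_pred_ltS k)).

(* w is the composite of the transpositions of ks, the last one acting first. *)
Definition expresses (w : 'S_n) (ks : seq 'I_n.-1) : Prop :=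
  forall r, w r = foldr (fun k r' => adj_transp k r') r ks.

Definition reduced (w : 'S_n) (ks : seq 'I_n.-1) : Prop :=
  expresses w ks /\ forall ks', expresses w ks' -> (size ks <= size ks')%N.

Definition reduced_word (w : 'S_n) : seq 'I_n.-1 :=
  xget [::] [set ks | reduced w ks]%classic.

Lemma expressesM w1 w2 ks1 ks2 : expresses w1 ks1 -> expresses w2 ks2 ->
  expresses (w2 * w1)%g (ks1 ++ ks2).
Proof. by move=> e1 e2 r; rewrite permM foldr_cat -e2 -e1. Qed.

Lemma expresses_tperm (i j : 'I_n) : exists ks, expresses (tperm i j) ks.
Proof.
wlog leij : i j / (i <= j)%N.
  by move=> W; case: (leqP i j) => [/W //|/ltnW /W]; rewrite tpermC.
have [d] : exists d, (j = i + d :> nat)%N by exists (j - i)%N; lia.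
elim: d j {leij} => [|d IHd] j ej.
  have -> : j = i by apply: val_inj; rewrite /= ej addn0.
  by exists [::] => r; rewrite tperm1 perm1.
have ltk : (i + d < n.-1)%N by have := ltn_ord j; lia.
pose k := Ordinal ltk; have [ks eks] := IHd (Ordinal (ord_pred_lt k)) erefl.
have ek : expresses (adj_transp k) [:: k] by [].
have ejk : Ordinal (ord_pred_ltS k) = j.
  by apply: val_inj; rewrite /= ej addnS.
have [d0|d0] := posnP d.
  exists [:: k]; suff -> : tperm i j = adj_transp k by [].
  by rewrite /adj_transp ejk; congr tperm; apply: val_inj; rewrite /= d0 addn0.
exists ([:: k] ++ (ks ++ [:: k])).
suff -> : tperm i j = (adj_transp k * tperm i (Ordinal (ord_pred_lt k))
                       * adj_transp k)%g by do !apply: expressesM.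
have nik : Ordinal (ord_pred_lt k) != i by apply/eqP => /(congr1 val) /=; lia.
have nij : j != i by apply/eqP => /(congr1 val) /=; lia.
rewrite /adj_transp ejk -[X in (X * _ * _)%g]tpermV -mulgA -conjgE tpermJ.
by rewrite tpermD ?tpermL.
Qed.

Lemma reducedP w : reduced w (reduced_word w).
Proof.
apply: (@xgetPex _ [::] [set ks | reduced w ks]%classic).
have [ks eks] : exists ks, expresses w ks.
  have [ts -> _] := prod_tpermP w.
  elim: ts => [|t ts [ks eks]]; first by exists [::] => r; rewrite big_nil perm1.
  have [ks' eks'] := expresses_tperm t.1 t.2.
  by exists (ks ++ ks'); rewrite big_cons; apply: expressesM.
pose P m := `[< exists2 ks, expresses w ks & size ks = m >].
have [m /asboolP[ks0 e0 <-] min] := ex_minnP (ex_intro P _ (asboolT (ex_intro2 _ _ ks eks erefl))).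
exists ks0; split=> // ks' e'; apply: min; apply/asboolP; by exists ks'.
Qed.

End ReducedExpressions.

(* The permutation with r |-> j + r for r < i and i + r |-> r for r < j.      *)
Definition block_swap (i j : nat) (k : 'I_(i + j)) : 'I_(i + j) :=
  cast_ord (addnC j i)
    match split k with inl r => rshift j r | inr r => lshift i r end.

Fact block_swap_inj i j : injective (@block_swap i j).
Proof.
move=> k l /cast_ord_inj; rewrite -[k]splitK -[l]splitK !unsplitK.
case: (split k) (split l) => [k'|k'] [l'|l'] => [/rshift_inj->|/eqP|/eqP|/lshift_inj->] //.
  by rewrite eq_rlshift.
by rewrite eq_lrshift.
Qed.

Definition chi (i j : nat) : 'S_(i + j) := perm (@block_swap_inj i j).

Section Beta.
Variables (K : fieldType) (C : lmodType K) (sigma : {linear C ⊗ C -> C ⊗ C}).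

Definition braid_perm n (w : 'S_n) (t : tensor_algebra C) : tensor_algebra C :=
  foldr (fun (k : 'I_n.-1) t' => braid_at sigma k t') t (reduced_word w).

Fact braid_perm_linear n (w : 'S_n) : linear (braid_perm w).
Proof.
by rewrite /braid_perm; elim: reduced_word => //= k ks IH a t t'; rewrite IH linearP.
Qed.
HB.instance Definition _ n (w : 'S_n) := GRing.isLinear.Build K
  (tensor_algebra C) (tensor_algebra C) _ (braid_perm w) (braid_perm_linear w).

Definition beta_word (u v : seq C) : tensor_algebra C ⊗ tensor_algebra C :=
  if nilp u || nilp v then word v \ox word u
  else deconcat (size v) (braid_perm (chi (size u) (size v)) (word (u ++ v))).

Definition beta :
    tensor_algebra C ⊗ tensor_algebra C -> tensor_algebra C ⊗ tensor_algebra C :=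
  word_lift2 beta_word.
HB.instance Definition _ := GRing.Linear.on beta.

Lemma betaE u v : beta (word u \ox word v) = beta_word u v.
Proof.
apply: word_lift2E => {u v} [v|u] p a c c' s; rewrite /beta_word /nilp.
  have [->|v0] := eqVneq (size v) 0%N.
    by rewrite !orbT word_multilinear purePr.
  rewrite !orbF !size_cat /= !addnS /= -!catA word_multilinear.
  by rewrite !linearP.
have [->|u0] := eqVneq (size u) 0%N.
  by rewrite /= word_multilinear purePl.
rewrite !size_cat /= !addnS /= !catA word_multilinear.
by rewrite !linearP.
Qed.

End Beta.

Section BraidedCoalgebra.
Variables (K : fieldType) (V : lmodType K).
Implicit Type (sigma : {linear V ⊗ V -> V ⊗ V}) (Delta : {linear V -> V ⊗ V}).

(* sigma_1 and sigma_2 on V (x) V (x) V. *)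
Definition braid1 sigma : (V ⊗ V) ⊗ V -> (V ⊗ V) ⊗ V := tensor_map sigma idfun.
HB.instance Definition _ sigma := GRing.Linear.on (braid1 sigma).

Definition braid2 sigma : (V ⊗ V) ⊗ V -> (V ⊗ V) ⊗ V :=
  @assocV K V V V \o tensor_map idfun sigma \o @assoc K V V V.
HB.instance Definition _ sigma := GRing.Linear.on (braid2 sigma).

Definition is_braiding sigma : Prop :=
  bijective sigma /\
  forall t, braid1 sigma (braid2 sigma (braid1 sigma t)) =
            braid2 sigma (braid1 sigma (braid2 sigma t)).

Definition is_coalgebra Delta (eps : {linear V -> K^o}) : Prop :=
  [/\ forall c, assoc (tensor_map Delta idfun (Delta c)) =
                tensor_map idfun Delta (Delta c),
      forall c, tensor_map eps idfun (Delta c) = (1 : K^o) \ox c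
    & forall c, tensor_map idfun eps (Delta c) = c \ox (1 : K^o)].

Definition braided_coalgebra Delta sigma : Prop :=
  [/\ exists eps, is_coalgebra Delta eps,
      is_braiding sigma,
      forall t, tensor_map idfun Delta (sigma t) =
        assoc (braid1 sigma (braid2 sigma (tensor_map Delta idfun t)))
    & forall t, tensor_map Delta idfun (sigma t) =
        braid2 sigma (braid1 sigma (assocV (tensor_map idfun Delta t)))].

End BraidedCoalgebra.

Section BraidedProduct.
Variables (K : fieldType) (A : lmodType K).
Variables (m : {linear A ⊗ A -> A}) (beta : {linear A ⊗ A -> A ⊗ A}).

Definition braid_middle : (A ⊗ A) ⊗ (A ⊗ A) -> (A ⊗ A) ⊗ (A ⊗ A) :=
  @assocV K A A (A ⊗ A)
    \o tensor_map idfun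
         (@assoc K A A A \o tensor_map beta idfun \o @assocV K A A A)
    \o @assoc K A A (A ⊗ A).
HB.instance Definition _ := GRing.Linear.on braid_middle.

Definition braided_product : (A ⊗ A) ⊗ (A ⊗ A) -> A ⊗ A :=
  tensor_map m m \o braid_middle.
HB.instance Definition _ := GRing.Linear.on braided_product.

End BraidedProduct.

Definition algebra_map (K : fieldType) (A B : lmodType K)
    (mA : A ⊗ A -> A) (oneA : A) (mB : B ⊗ B -> B) (oneB : B)
    (f : {linear A -> B}) : Prop :=
  f oneA = oneB /\ forall t, f (mA t) = mB (tensor_map f f t).

Section Phi.
Variables (K : fieldType) (C : lmodType K).
Variables (Delta : {linear C -> C ⊗ C}) (sigma : {linear C ⊗ C -> C ⊗ C}).
Local Notation T := (tensor_algebra C).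

Definition phi (c : C) : T ⊗ T :=
  word [::] \ox letter c + letter c \ox word [::]
  + tensor_map (@letter K C) (@letter K C) (Delta c).

Fact phi_linear : linear phi.
Proof.
exact: (linearP ((pure (word [::]) \o @letter K C)
  \+ (purer (word [::]) \o @letter K C)
  \+ (tensor_map (@letter K C) (@letter K C) \o Delta))).
Qed.
HB.instance Definition _ := GRing.isLinear.Build K C (T ⊗ T) _ phi phi_linear.

Definition algebra_map_extending_phi (Phi : {linear T -> T ⊗ T}) : Prop :=
  algebra_map (@concat K C) (word [::])
    (braided_product (@concat K C) (beta sigma)) (word [::] \ox word [::]) Phi
  /\ forall c, Phi (letter c) = phi c.

End Phi.

(* Main.v *)
Require Import Defs.
From HB Require Import structures.
From mathcomp Require Import all_boot all_algebra perm.
From mathcomp Require Import zify.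

Set Implicit Arguments.
Unset Strict Implicit.
Unset Printing Implicit Defensive.

Import GRing.Theory.
Local Open Scope ring_scope.

(** Everything is computed with operators acting at a position of a word, first
    on the words of [T(C)], then on the words of [T(T(C))], that is on the tensor
    powers of [T(C)], where associativity of the tensor product costs nothing.

    The braiding. On [C^i (x) C^j], [beta] is a product of operators [sigma_k]
    along some reduced word of the block transposition [chi i j]. If one only
    remembers from which block each letter comes, such a word sorts a sequence
    of bits by exchanging 0 1 into 1 0. Two possible exchanges are never
    adjacent, so all reduced words are related by commutations of far
    generators ([sorts_unique]), and [beta] may be computed along the word
    [crossing i j] ([beta_crossing]), in which the letters of the first block
    pass one after the other. Then [beta] is compatible with concatenation on
    both sides, satisfies the braid relation ([crossing_braid]), and has for
    inverse the map built from the inverse of [sigma] ([beta_cancel]).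

    The coproduct. Put [phi 1 = 1 (x) 1]; then [phi] is coassociative and
    compatible with [beta], because [Delta] is coassociative and compatible with
    [sigma]. The map [Phi] is defined by [Phi (c u) = phi c . Phi u] in the
    braided product of [T(C) (x) T(C)]. By induction on the degree one obtains
    the compatibility of [Phi] with [beta] ([Phi_beta_l], [Phi_beta_r]), its
    multiplicativity ([Phi_concat]) and its coassociativity ([Phi_coassoc]). Each
    induction step is an equality of string diagrams made of products,
    crossings and copies of [phi]: all products are moved after all crossings,
    and all copies of [phi] before them, and the two braids left in the middle
    are equal. The counit is the augmentation, which is 1 on the empty word and 0
    on other words. *)

Reserved Notation "x ** y" (at level 40, left associativity).
Notation "x ** y" := (concat (x \ox y)) : ring_scope.

(** * The tensor algebra: concatenation and degree *)

Section Grading.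
Variables (K : fieldType) (V : lmodType K).
Local Notation T := (tensor_algebra V).
Implicit Types (x y z t : T) (W : lmodType K).

Lemma cat_word (u v : seq V) : word u ** word v = word (u ++ v).
Proof. exact: concatE. Qed.

Lemma catTA x y z : x ** (y ** z) = x ** y ** z.
Proof.
apply: (word_ext (f := @concat K V \o purer (y ** z))
                 (h := @concat K V \o purer z \o @concat K V \o purer y)) => u /=.
apply: (word_ext (f := @concat K V \o pure (word u) \o @concat K V \o purer z)
                 (h := @concat K V \o purer z \o @concat K V \o pure (word u))) => v /=.
apply: (word_ext (f := @concat K V \o pure (word u) \o @concat K V \o pure (word v))
                 (h := @concat K V \o pure (word u ** word v))) => w /=.
by rewrite /purer !cat_word catA.
Qed.

Lemma cat1T x : word [::] ** x = x.
Proof.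
by apply: (word_ext (f := @concat K V \o pure (word [::])) (h := @idfun T)) => w /=;
  rewrite cat_word.
Qed.

Lemma catT1 x : x ** word [::] = x.
Proof.
by apply: (word_ext (f := @concat K V \o purer (word [::])) (h := @idfun T)) => w /=;
  rewrite /purer cat_word cats0.
Qed.

Lemma cat0T x : 0 ** x = 0.
Proof. exact: (linear0 (@concat K V \o purer x)). Qed.

Lemma catT0 x : x ** 0 = 0.
Proof. exact: (linear0 (@concat K V \o pure x)). Qed.

Lemma catDl x x' y : (x + x') ** y = x ** y + x' ** y.
Proof. exact: (linearD (@concat K V \o purer y)). Qed.

Lemma word_cons c w : word (c :: w) = letter c ** word w :> T.
Proof. by rewrite cat_word. Qed.

Lemma word2_pure (c d : V) : word2 (c \ox d) = letter c ** letter d.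
Proof. by rewrite word2E cat_word. Qed.

Definition proj (n : nat) : T -> T :=
  word_lift (fun w => if size w == n then word w else 0).
HB.instance Definition _ n := GRing.Linear.on (proj n).

Lemma projE n w : proj n (word w) = if size w == n then word w else 0.
Proof.
rewrite /proj word_liftE // => p a c c' s; rewrite !size_cat /=.
by case: eqP => _; rewrite ?word_multilinear // scaler0 addr0.
Qed.

(** Homogeneity of degree [n] is being fixed by the projection, so that it
    passes through linear maps without decomposing [t] into words. *)
Definition hom (n : nat) t := proj n t = t.

Lemma hom_word n w : size w = n -> hom n (word w).
Proof. by rewrite /hom projE => ->; rewrite eqxx. Qed.

Lemma hom0 n : hom n 0.
Proof. exact: linear0. Qed.

(** Induction on homogeneous elements, which are spanned by the words of the
    given length. *)
Lemma hom_ext n W (f h : {linear T -> W}) :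
  (forall w, size w = n -> f (word w) = h (word w)) ->
  forall t, hom n t -> f t = h t.
Proof.
move=> fh t <-; apply: (word_ext (f := f \o proj n) (h := h \o proj n)) => w /=.
by rewrite projE; case: eqP => [/fh //|_]; rewrite !linear0.
Qed.

Lemma hom_map m n (f : {linear T -> T}) :
  (forall w, size w = m -> hom n (f (word w))) -> forall t, hom m t -> hom n (f t).
Proof. exact: (hom_ext (f := proj n \o f) (h := f)). Qed.

Lemma hom_cat m n x y : hom m x -> hom n y -> hom (m + n) (x ** y).
Proof.
move=> hx hy; apply: (hom_map (f := @concat K V \o purer y) _ hx) => u su /=.
apply: (hom_map (f := @concat K V \o pure (word u)) _ hy) => v sv /=.
by rewrite cat_word; apply: hom_word; rewrite size_cat su sv.
Qed.

Lemma hom_letter c : hom 1 (letter c).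
Proof. exact: hom_word. Qed.

Lemma hom_word2 s : hom 2 (word2 s).
Proof.
by apply: (tensor_ext (f := proj 2 \o @word2 K V) (h := @word2 K V)) => c d /=;
  rewrite word2E; apply: hom_word.
Qed.

Lemma deconcat_hom n x y : hom n x -> deconcat n (x ** y) = x \ox y.
Proof.
apply: (hom_ext (f := deconcat n \o @concat K V \o purer y) (h := purer y)) => u su /=.
apply: (word_ext (f := deconcat n \o @concat K V \o pure (word u))
                 (h := pure (word u))) => v /=.
by rewrite cat_word deconcatE take_size_cat // drop_size_cat.
Qed.

End Grading.

(** * Operators at a position of a word *)

Section Shift.
Variables (K : fieldType) (V : lmodType K).
Local Notation T := (tensor_algebra V).
Implicit Types (x y z t : T) (F G H : {linear T -> T}).

(** [id^k (x) F]. The value 0 on words of fewer than [k] letters makes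
    [shift k] compatible with composition and linear in [F]; it does not
    preserve the identity. *)
Definition shift (k : nat) F : T -> T :=
  @concat K V \o tensor_map (@proj K V k) F \o deconcat k.
HB.instance Definition _ k F := GRing.Linear.on (shift k F).

Lemma shiftE k F w : shift k F (word w) =
  if (k <= size w)%N then word (take k w) ** F (word (drop k w)) else 0.
Proof.
rewrite /shift /= deconcatE tensor_mapE /= projE size_take_min.
case: leqP => lek; first by rewrite ifT //; lia.
by rewrite ifF ?cat0T //; lia.
Qed.

Lemma shift_cat k F x y : hom k x -> shift k F (x ** y) = x ** F y.
Proof. by move=> hx; rewrite /shift /= deconcat_hom // tensor_mapE /= hx. Qed.

Lemma shift_short k n F t : hom n t -> (n < k)%N -> shift k F t = 0.
Proof.
move=> ht ltn; apply: (hom_ext (f := shift k F) (h := \0) _ ht) => w sw /=.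
by rewrite shiftE leqNgt sw ltn.
Qed.

Lemma shift0 F t : shift 0 F t = F t.
Proof. by rewrite -[t]cat1T shift_cat ?cat1T //; exact: hom_word. Qed.

Lemma eq_shift k F G : F =1 G -> shift k F =1 shift k G.
Proof.
by move=> FG; apply: word_ext => w /=; rewrite !shiftE FG.
Qed.

Lemma shift_comp k F G t : shift k F (shift k G t) = shift k (F \o G) t.
Proof.
apply: (word_ext (f := shift k F \o shift k G) (h := shift k (F \o G))) => w /=.
rewrite !shiftE; case: leqP => lek; last exact: linear0.
by rewrite shift_cat //; apply: hom_word; rewrite size_takel.
Qed.

Lemma shift_shift k l F t : shift k (shift l F) t = shift (k + l) F t.
Proof.
apply: (word_ext (f := shift k (shift l F)) (h := shift (k + l) F)) => w /=.
rewrite !shiftE; case: leqP => lek; last by rewrite ifF //; lia.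
rewrite /= shiftE size_drop.
have -> : (l <= size w - k)%N = (k + l <= size w)%N by lia.
case: ifP => // lek2; last by rewrite catT0.
by rewrite catTA cat_word drop_drop takeD addnC.
Qed.

End Shift.

(** A map from [V^a] to [V^b], carried by an endomorphism of [T(V)] so that no
    tensor power needs a type of its own; [op_head] composes it with the
    projection to degree [a]. *)
Record local_op (K : fieldType) (V : lmodType K) (a b : nat) := LocalOp {
  op_fun : {linear tensor_algebra V -> tensor_algebra V};
  op_hom : forall w, size w = a -> hom b (op_fun (word w)) }.

Section At.
Variables (K : fieldType) (V : lmodType K).
Local Notation T := (tensor_algebra V).
Local Notation local_op := (local_op V).
Implicit Types (x y z t : T).

Definition op_head a b (F : local_op a b) : T -> T :=
  @concat K V \o tensor_map (op_fun F \o @proj K V a) idfun \o deconcat a.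
HB.instance Definition _ a b F := GRing.Linear.on (@op_head a b F).

Lemma op_head_cat a b (F : local_op a b) x y :
  hom a x -> op_head F (x ** y) = op_fun F x ** y.
Proof. by move=> hx; rewrite /op_head /= deconcat_hom // tensor_mapE /= hx. Qed.

Lemma op_head_short a b (F : local_op a b) n t :
  hom n t -> (n < a)%N -> op_head F t = 0.
Proof.
move=> ht ltn; apply: (hom_ext (f := op_head F) (h := \0) _ ht) => w sw /=.
rewrite /op_head /= deconcatE tensor_mapE /= projE ifF ?linear0 ?cat0T //.
by apply/negbTE/eqP; rewrite size_take_min; lia.
Qed.

Lemma op_fun_hom a b (F : local_op a b) x : hom a x -> hom b (op_fun F x).
Proof. exact: (hom_map (@op_hom _ _ _ _ F)). Qed.

Definition at_ (k : nat) a b (F : local_op a b) : T -> T := shift k (op_head F).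
HB.instance Definition _ k a b F := GRing.Linear.on (@at_ k a b F).

Lemma at_cat k a b (F : local_op a b) x y z : hom k x -> hom a y ->
  at_ k F (x ** y ** z) = x ** op_fun F y ** z.
Proof. by move=> hx hy; rewrite -!catTA /at_ shift_cat //= op_head_cat. Qed.

Lemma at0_cat a b (F : local_op a b) y z : hom a y ->
  at_ 0 F (y ** z) = op_fun F y ** z.
Proof. by move=> hy; rewrite /at_ shift0 /= op_head_cat. Qed.

Lemma at0E a b (F : local_op a b) y : hom a y -> at_ 0 F y = op_fun F y.
Proof. by move=> hy; rewrite -[y in LHS]catT1 at0_cat // catT1. Qed.

Lemma at_short k a b (F : local_op a b) n t :
  hom n t -> (n < k + a)%N -> at_ k F t = 0.
Proof.
move=> ht ltn; apply: (hom_ext (f := at_ k F) (h := \0) _ ht) => w sw /=.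
rewrite /at_ shiftE; case: leqP => // lek.
rewrite /= (@op_head_short _ _ F (size w - k)%N) ?catT0 //; last by lia.
by apply: hom_word; rewrite size_drop.
Qed.

Lemma at_zero k a b (F : local_op a b) : at_ k F 0 = 0.
Proof. exact: linear0. Qed.

Lemma at_add k a b (F : local_op a b) x y : at_ k F (x + y) = at_ k F x + at_ k F y.
Proof. exact: linearD. Qed.

Lemma at_addn k l a b (F : local_op a b) t :
  at_ (k + l) F t = shift k (at_ l F) t.
Proof. by rewrite /at_ shift_shift. Qed.

Lemma at_shift_cat k l a b (F : local_op a b) x y : hom k x ->
  at_ (k + l) F (x ** y) = x ** at_ l F y.
Proof. by move=> hx; rewrite at_addn shift_cat. Qed.

Lemma at_hom k a b (F : local_op a b) n t :
  hom (k + a + n) t -> hom (k + b + n) (at_ k F t).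
Proof.
apply: hom_map => w sw /=.
rewrite -(cat_take_drop (k + a) w) -(cat_take_drop k (take _ w)) -!cat_word.
have stk : size (take (k + a) w) = (k + a)%N by rewrite size_takel; lia.
have sz1 : size (take k (take (k + a) w)) = k by rewrite size_takel; lia.
have sz2 : size (drop k (take (k + a) w)) = a by rewrite size_drop; lia.
have sz3 : size (drop (k + a) w) = n by rewrite size_drop; lia.
rewrite at_cat; [|exact: hom_word..].
apply: hom_cat; last exact: hom_word.
by apply: hom_cat; [exact: hom_word | apply/op_fun_hom/hom_word].
Qed.

Lemma at_cat_left k a b (F : local_op a b) n x y :
  hom n x -> (k + a <= n)%N -> at_ k F (x ** y) = at_ k F x ** y.
Proof.
move=> hx len.
apply: (hom_ext (f := at_ k F \o @concat K V \o purer y)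
                (h := @concat K V \o purer y \o at_ k F) _ hx) => w sw /=.
rewrite /purer -(cat_take_drop (k + a) w) -(cat_take_drop k (take _ w)) -!cat_word.
have stk : size (take (k + a) w) = (k + a)%N by rewrite size_takel; lia.
have sz1 : size (take k (take (k + a) w)) = k by rewrite size_takel; lia.
have sz2 : size (drop k (take (k + a) w)) = a by rewrite size_drop; lia.
rewrite -[X in at_ k F X]catTA !at_cat; try exact: hom_word.
by rewrite !catTA.
Qed.

(** Operators on disjoint groups of letters commute. The right-hand one moves
    from [l] to [l'] because [F] replaces [a] letters by [b]. Since both sides
    vanish on words that are too short, there is no condition on [t]. *)
Lemma at_comm a b c d (F : local_op a b) (G : local_op c d) k l l' t :
    (k + a <= l)%N -> (l' + a = l + b)%N ->
  at_ k F (at_ l G t) = at_ l' G (at_ k F t).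
Proof.
move=> lel eql.
have [e [-> ->]] : exists e, (l = k + (a + e) /\ l' = k + (b + e))%N.
  by exists (l - k - a)%N; lia.
rewrite /at_ -(shift_shift k (a + e)%N) -(shift_shift k (b + e)%N) !shift_comp.
apply: eq_shift => {}t /=.
apply: (word_ext (f := op_head F \o shift (a + e)%N (op_head G))
                 (h := shift (b + e)%N (op_head G) \o op_head F)) => w /=.
have [lta|lea] := ltnP (size w) a.
  have hw : hom (size w) (word w) by exact: hom_word.
  by rewrite (op_head_short _ hw) // linear0 (shift_short _ hw) ?linear0 //; lia.
rewrite -(cat_take_drop a w) -!cat_word.
set u := take a w; set v := drop a w.
have hu : hom a (word u) by apply: hom_word; rewrite size_takel.
rewrite op_head_cat // cat_word shiftE size_cat.
have su : size u = a by rewrite size_takel.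
rewrite su leq_add2l; case: leqP => lte; last first.
  have hFv : hom (b + size v) (op_fun F (word u) ** word v).
    by apply: hom_cat; [apply: op_fun_hom | apply: hom_word].
  by rewrite linear0 (shift_short _ hFv) ?ltn_add2l.
have -> : take (a + e) (u ++ v) = u ++ take e v.
  by rewrite take_cat su ltnNge leq_addr /= addKn.
have -> : drop (a + e) (u ++ v) = drop e v.
  by rewrite drop_cat su ltnNge leq_addr /= addKn.
rewrite -cat_word -catTA op_head_cat //.
rewrite -[in RHS](cat_take_drop e v) -cat_word [in RHS]catTA shift_cat.
  by rewrite catTA.
apply: hom_cat; first exact: op_fun_hom.
by apply: hom_word; rewrite size_takel //; lia.
Qed.

End At.

Arguments at_comm {K V a b c d} F G k l l' {t} _ _.
Opaque at_.

(** An identity [H] between composites of operators at positions 0, 1 and 2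
    holds at positions [k], [k.+1] and [k.+2], because [shift k] commutes with
    composition. *)
Ltac shift_relation H k t :=
  have := eq_shift k H t; rewrite -?shift_comp -!at_addn ?addn0 ?addn1 ?addn2; apply.

Section Ops.
Variables (K : fieldType) (V : lmodType K).
Local Notation T := (tensor_algebra V).

Definition unletter : T -> V := word_lift (fun w => if w is [:: c] then c else 0).
HB.instance Definition _ := GRing.Linear.on unletter.

Lemma letterK : cancel (@letter K V) unletter.
Proof.
move=> c; rewrite /unletter word_liftE // => -[|d [|e p]] a {}c c' [|f s] //=;
  by rewrite scaler0 addr0.
Qed.

Definition unword2 : T -> V ⊗ V :=
  word_lift (fun w => if w is [:: c; d] then c \ox d else 0).
HB.instance Definition _ := GRing.Linear.on unword2.

Lemma word2K : cancel (@word2 K V) unword2.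
Proof.
pose f : {linear V ⊗ V -> V ⊗ V} := unword2 \o @word2 K V.
suff fK : f =1 @idfun (V ⊗ V) by exact: fK.
apply: (tensor_ext (h := @idfun (V ⊗ V))) => c d; rewrite /f /=.
rewrite word2E /unword2 word_liftE // => -[|e [|g [|h p]]] a {}c c' [|i [|k s]] //=;
  by rewrite ?scaler0 ?addr0 ?purePl ?purePr.
Qed.

Section Op11.
Variable f : {linear V -> V}.
Fact op11_hom w : size w = 1%N -> hom 1 ((@letter K V \o f \o unletter) (word w)).
Proof. by move=> _; apply: hom_letter. Qed.
Definition op11 := LocalOp op11_hom.
Lemma op11E c : op_fun op11 (letter c) = letter (f c).
Proof. by rewrite /= letterK. Qed.
End Op11.

Section Op22.
Variable f : {linear V ⊗ V -> V ⊗ V}.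
Fact op22_hom w : size w = 2 -> hom 2 ((@word2 K V \o f \o unword2) (word w)).
Proof. by move=> _; apply: hom_word2. Qed.
Definition op22 := LocalOp op22_hom.
Lemma op22E s : op_fun op22 (word2 s) = word2 (f s).
Proof. by rewrite /= word2K. Qed.
End Op22.

Section Op21.
Variable f : {linear V ⊗ V -> V}.
Fact op21_hom w : size w = 2 -> hom 1 ((@letter K V \o f \o unword2) (word w)).
Proof. by move=> _; apply: hom_letter. Qed.
Definition op21 := LocalOp op21_hom.
Lemma op21E s : op_fun op21 (word2 s) = letter (f s).
Proof. by rewrite /= word2K. Qed.
End Op21.

Section Op12.
Variable f : {linear V -> V ⊗ V}.
Fact op12_hom w : size w = 1%N -> hom 2 ((@word2 K V \o f \o unletter) (word w)).
Proof. by move=> _; apply: hom_word2. Qed.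
Definition op12 := LocalOp op12_hom.
Lemma op12E c : op_fun op12 (letter c) = word2 (f c).
Proof. by rewrite /= letterK. Qed.
End Op12.

Section Op10.
Variable f : {linear V -> K^o}.
Definition op10_fun : T -> T :=
  word_lift (fun w => if w is [:: c] then (f c : K) *: word [::] else 0).
HB.instance Definition _ := GRing.Linear.on op10_fun.
Lemma op10_letter c : op10_fun (letter c) = (f c : K) *: word [::].
Proof.
rewrite /op10_fun word_liftE // => -[|d [|e p]] a {}c c' [|g s] //=;
  by rewrite ?scaler0 ?addr0 // linearP scalerDl scalerA.
Qed.
Fact op10_hom w : size w = 1%N -> hom 0 (op10_fun (word w)).
Proof.
case: w => [|c []] // _; rewrite op10_letter /hom linearZ /=.
by rewrite hom_word.
Qed.
Definition op10 := LocalOp op10_hom.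
Lemma op10E c : op_fun op10 (letter c) = (f c : K) *: word [::].
Proof. exact: op10_letter. Qed.
End Op10.

End Ops.

(** * Words for the block transpositions *)

Section Crossings.

Definition adj_swap (k r : nat) : nat :=
  if r == k then k.+1 else if r == k.+1 then k else r.

Lemma adj_swapK k : involutive (adj_swap k).
Proof. by move=> r; rewrite /adj_swap; do !case: eqP => //=; lia. Qed.

(** In a word, as in the operators below, the last position acts first: [pass j]
    takes the first letter to the right over the next [j] letters, and
    [crossing i j] does this for the [i] letters of a block, the last one
    first. *)
Definition pass (j : nat) : seq nat := rev (iota 0 j).

Fixpoint crossing (i j : nat) : seq nat :=
  if i is i'.+1 then pass j ++ map succn (crossing i' j) else [::].

Lemma size_crossing i j : size (crossing i j) = (i * j)%N.
Proof. by elim: i => //= i IH; rewrite size_cat size_rev size_iota size_map IH mulSn. Qed.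

Lemma crossing_lt i j k : k \in crossing i j -> (k.+1 < i + j)%N.
Proof.
elim: i k => //= i IH k; rewrite mem_cat /pass mem_rev mem_iota.
case/orP=> [|/mapP[l /IH ltl ->]]; first by lia.
by rewrite addSn ltnS.
Qed.

Lemma crossing0 i : crossing i 0 = [::].
Proof. by elim: i => //= i ->. Qed.

Lemma crossing1 j : crossing 1 j = pass j.
Proof. by rewrite /= cats0. Qed.

Lemma crossingS i j : crossing i.+1 j = pass j ++ map succn (crossing i j).
Proof. by []. Qed.

Lemma mem_pass j k : (k \in pass j) = (k < j)%N.
Proof. by rewrite mem_rev mem_iota. Qed.

Lemma passS j : pass j.+1 = j :: pass j.
Proof. by rewrite /pass -addn1 iotaD rev_cat. Qed.

Lemma passD j l : pass (j + l) = map (addn j) (pass l) ++ pass j.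
Proof. by rewrite /pass iotaD rev_cat map_rev -iotaDl addn0. Qed.

Lemma crossingDl i j l :
  crossing (i + j) l = crossing i l ++ map (addn i) (crossing j l).
Proof.
elim: i => [|i IH] /=; first by rewrite (eq_map add0n) map_id.
by rewrite IH map_cat -map_comp catA.
Qed.

Lemma foldr_swap_succ ks r :
  foldr adj_swap r.+1 (map succn ks) = (foldr adj_swap r ks).+1.
Proof. by elim: ks => //= k ks ->; rewrite /adj_swap !eqSS; repeat (case: ifP => ? //). Qed.

Lemma foldr_swap0 ks : foldr adj_swap 0 (map succn ks) = 0.
Proof. by elim: ks => //= k ks ->. Qed.

Lemma foldr_swap_pass j r : foldr adj_swap r (pass j) =
  if r == 0 then j else if (r <= j)%N then r.-1 else r.
Proof.
elim: j => [|j IH]; first by case: r.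
rewrite passS /= IH /adj_swap.
case: r {IH} => [|r] /=; first by rewrite eqxx.
by case: (ltnP r j) => ltrj; repeat (case: ifP => ? //); lia.
Qed.

Lemma foldr_swap_crossing i j r : (r < i + j)%N ->
  foldr adj_swap r (crossing i j) = if (r < i)%N then (j + r)%N else (r - i)%N.
Proof.
elim: i r => [|i IH] [|r] //= ltr; rewrite ?subn0 // foldr_cat.
  by rewrite foldr_swap0 foldr_swap_pass addn0.
rewrite foldr_swap_succ IH // foldr_swap_pass ltnS /=.
by case: (ltnP r i) => ltri; repeat (case: ifP => ? //); lia.
Qed.

Lemma foldr_swap_rev ks r : foldr adj_swap (foldr adj_swap r ks) (rev ks) = r.
Proof.
elim: ks r => //= k ks IH r.
by rewrite rev_cons -cats1 foldr_cat /= adj_swapK IH.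
Qed.

End Crossings.

Arguments crossing : simpl never.

(** * Uniqueness of reduced words up to far commutations *)

Section SortingBits.

Fixpoint swap_bits (k : nat) (b : bitseq) : bitseq :=
  match k, b with
  | 0, x :: y :: s => y :: x :: s
  | k'.+1, x :: s => x :: swap_bits k' s
  | _, _ => b
  end.

Fixpoint inversions (b : bitseq) : nat :=
  if b is x :: s then (x * count negb s + inversions s)%N else 0.

(** A bit tells from which of the two blocks a letter comes. Each step of a
    sorting word, starting from its right end, turns an adjacent pair 0 1 into
    1 0. The order of the letters inside a block can be forgotten, as no reduced
    word of a block transposition exchanges two letters of the same block. *)
Inductive sorts : seq nat -> bitseq -> Prop :=
| SortsNil i j : sorts [::] (nseq i false ++ nseq j true)
| SortsCons p s ks : sorts ks (p ++ [:: false, true & s]) ->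
    sorts (size p :: ks) (p ++ [:: true, false & s]).

Lemma count_swap_bits k b : count negb (swap_bits k b) = count negb b.
Proof. by elim: k b => [|k IH] [|x [|y b]] //=; rewrite ?IH //; exact: addnCA. Qed.

Lemma size_swap_bits k b : size (swap_bits k b) = size b.
Proof. by elim: k b => [|k IH] [|x [|y b]] //=; rewrite IH. Qed.

Lemma nth_swap_bits k b r : (k.+1 < size b)%N ->
  nth false (swap_bits k b) (adj_swap k r) = nth false b r.
Proof.
elim: k b r => [|k IH] [|x [|y b]] //= r ltk; first by case: r => [|[|r]].
case: r => [//|r]; have {}IH := IH (y :: b) r ltk.
rewrite -[RHS]/(nth false (y :: b) r) -IH /adj_swap !eqSS.
by repeat (case: ifP => ? //).
Qed.

Lemma swap_bits_cat p x y s :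
  swap_bits (size p) (p ++ [:: x, y & s]) = p ++ [:: y, x & s].
Proof. by elim: p => //= z p ->. Qed.

Lemma inversions_up p s : inversions (p ++ [:: true, false & s]) =
  (inversions (p ++ [:: false, true & s])).+1.
Proof. by elim: p => [|x p IH] /=; rewrite ?IH ?count_cat /=; lia. Qed.

Lemma inversions_swap k b : (inversions (swap_bits k b) <= inversions b)%N \/
  exists p s, b = p ++ [:: false, true & s] /\ size p = k.
Proof.
elim: k b => [|k IH] [|x [|y b]] /=; try by left.
- case: x y => [] [] /=; try by left; lia.
  by right; exists [::], b.
- by case: k {IH}; left.
- case: (IH (y :: b)) => [le|[p [s [-> <-]]]]; last by right; exists (x :: p), s.
  by left; rewrite count_swap_bits leq_add2l.
Qed.

Lemma inversions_sorted i j : inversions (nseq i false ++ nseq j true) = 0.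
Proof.
elim: i => [|i IH] /=; last by rewrite IH.
by elim: j => //= j ->; rewrite count_nseq /= mul0n.
Qed.

Lemma inversions_block i j : inversions (nseq j true ++ nseq i false) = (i * j)%N.
Proof.
elim: j => [|j IH] /=; first by rewrite muln0 -[nseq i _]cats0 (inversions_sorted i 0).
by rewrite IH count_cat !count_nseq /=; lia.
Qed.

Lemma inversions_foldr ks b :
  (inversions (foldr swap_bits b ks) <= inversions b + size ks)%N.
Proof.
elim: ks => [|k ks IH] /=; first by rewrite addn0.
case: (inversions_swap k (foldr swap_bits b ks)) => [|[p [s [e <-]]]]; first by lia.
by move: IH; rewrite e swap_bits_cat inversions_up; lia.
Qed.

(** A step creates at most one inversion, so a word no longer than the number
    of inversions it produces must create one at each step. *)
Lemma sorts_foldr i j ks (b := foldr swap_bits (nseq i false ++ nseq j true) ks) :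
  (size ks <= inversions b)%N -> sorts ks b.
Proof.
rewrite /b {b}; elim: ks => [|k ks IH] /=; first by move=> _; exact: SortsNil.
have := inversions_foldr ks (nseq i false ++ nseq j true).
rewrite inversions_sorted add0n.
case: (inversions_swap k (foldr swap_bits (nseq i false ++ nseq j true) ks))
  => [|[p [s [e <-]]]]; first by lia.
move: IH; rewrite e swap_bits_cat inversions_up => IH _ lek.
exact/SortsCons/IH.
Qed.

Lemma sorts_size ks b : sorts ks b -> size ks = inversions b.
Proof.
elim=> {ks b} [i j|p s ks _ IH]; first by rewrite inversions_sorted.
by rewrite inversions_up /= IH.
Qed.

Lemma sorts_ex b : exists ks, sorts ks b.
Proof.
have [n] := ubnP (inversions b); elim: n b => // n IH b ltb.
have [[i [j ->]]|[p [s eb]]] : (exists i j, b = nseq i false ++ nseq j true) \/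
    (exists p s, b = p ++ [:: true, false & s]).
- elim: b {ltb} => [|x b [[i [j ->]]|[p [s ->]]]]; first by left; exists 0, 0.
    case: x; last by left; exists i.+1, j.
    case: i => [|i]; first by left; exists 0, j.+1.
    by right; exists [::], (nseq i false ++ nseq j true).
  by right; exists (x :: p), s.
- by exists [::]; exact: SortsNil.
have [|ks sks] := IH (p ++ [:: false, true & s]).
  by rewrite eb inversions_up in ltb.
by exists (size p :: ks); rewrite eb; exact: SortsCons.
Qed.

Lemma descents_far p s p' s' :
    p ++ [:: true, false & s] = p' ++ [:: true, false & s'] -> (size p < size p')%N ->
  exists q, p' = p ++ [:: true, false & q] /\ s = q ++ [:: true, false & s'].
Proof.
elim: p p' => [|x p IH] [|y p'] //=.
  by case=> <-; case: p' => //= z q [<- ->] _; exists q.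
case=> -> e; rewrite ltnS => lt.
by have [q [-> ->]] := IH _ e lt; exists q.
Qed.

(** The diamond argument. If two words sorting [b] begin with distinct
    positions, these are descents of [b], and two descents of a sequence of
    bits are never adjacent (they would need a bit equal to 0 and 1). Removing
    both descents gives a sequence that some word sorts, which closes the
    diamond with a single commutation of far positions. *)
Lemma sorts_unique (X : Type) (f : nat -> X -> X) :
    (forall k l x, (k.+1 < l)%N -> f k (f l x) = f l (f k x)) ->
  forall ks ks' b, sorts ks b -> sorts ks' b ->
  forall x, foldr f x ks = foldr f x ks'.
Proof.
move=> fC ks ks' b sks sks' x.
have [n] := ubnP (size ks); elim: n ks ks' b sks sks' => // n IH ks ks' b sks.
case: sks (sks) => {ks b} [i j|p s ks sks] sks0.
  move/sorts_size; rewrite inversions_sorted => /size0nil -> //.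
move eb: (p ++ _) sks0 => b sks0 sks'; case: sks' eb sks0 => {ks'} [i j|p' s' ks' sks'] eb sks0.
  by have := inversions_sorted i j; rewrite -eb inversions_up.
rewrite /= ltnS => ltn.
have [eqp|neqp] := eqVneq (size p) (size p').
  move/eqP: eb; rewrite eqseq_cat // => /andP[/eqP ep /eqP[es]].
  by rewrite ep es in sks *; congr f; apply: IH sks sks' _.
have ltn' : (size ks' < n)%N.
  have := sorts_size sks0; rewrite /= inversions_up => -[e1].
  by rewrite (sorts_size sks') -e1.
wlog ltp : p s ks sks p' s' ks' sks' ltn ltn' eb neqp {sks0} / (size p < size p')%N.
  move=> W; move: (neqp); rewrite neq_ltn => /orP[] lt.
  - exact: (W p s ks sks p' s' ks').
  - by apply: esym; apply: (W p' s' ks' sks' p s ks); rewrite // eq_sym.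
have [q [ep es]] := descents_far eb ltp.
have [ks2 sks2] := sorts_ex (p ++ [:: false, true & q] ++ [:: false, true & s']).
have s1 : sorts (size p' :: ks2) (p ++ [:: false, true & s]).
  have -> : size p' = size (p ++ [:: false, true & q]) by rewrite ep !size_cat.
  by rewrite es -cat_cons -cat_cons catA; apply: SortsCons; rewrite -catA.
have s2 : sorts (size p :: ks2) (p' ++ [:: false, true & s']).
  by rewrite ep -catA; apply: SortsCons.
rewrite (IH _ _ _ sks s1) // (IH _ _ _ sks' s2) //= fC //.
by rewrite ep size_cat /=; lia.
Qed.

(** The sequence of [j] ones followed by [i] zeros has exactly [i * j]
    inversions, so that [sorts_foldr] applies. *)
Lemma sorts_crossing i j ks :
    (forall k, k \in ks -> (k.+1 < i + j)%N) ->
    (forall r, (r < i + j)%N ->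
       foldr adj_swap r ks = if (r < i)%N then (j + r)%N else (r - i)%N) ->
    (size ks <= i * j)%N ->
  sorts ks (nseq j true ++ nseq i false).
Proof.
move=> ks_lt ksE szks.
set b0 := nseq i false ++ nseq j true.
have szb0 : size b0 = (i + j)%N by rewrite size_cat !size_nseq.
have [szb nthb] : size (foldr swap_bits b0 ks) = (i + j)%N /\ forall r,
    nth false (foldr swap_bits b0 ks) (foldr adj_swap r ks) = nth false b0 r.
  elim: ks ks_lt {ksE szks} => //= k ks IH ks_lt.
  have [|sz nthE] := IH; first by move=> l lk; apply: ks_lt; rewrite inE lk orbT.
  split=> [|r]; first by rewrite size_swap_bits.
  by rewrite nth_swap_bits ?nthE // sz; apply: ks_lt; rewrite inE eqxx.
have eb : foldr swap_bits b0 ks = nseq j true ++ nseq i false.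
  apply: (@eq_from_nth _ false); first by rewrite szb size_cat !size_nseq addnC.
  move=> r; rewrite szb => ltr; rewrite nth_cat !size_nseq !nth_nseq.
  case: (ltnP r j) => ltrj.
    have := nthb (i + r)%N; rewrite ksE; last by lia.
    rewrite ltnNge leq_addr /= addKn => ->.
    by rewrite nth_cat size_nseq ltnNge leq_addr /= addKn nth_nseq ltrj.
  have := nthb (r - j)%N; rewrite ksE; last by lia.
  have -> : (r - j < i)%N by lia.
  rewrite subnKC // => ->.
  rewrite nth_cat size_nseq nth_nseq.
  by have -> : (r - j < i)%N by lia.
by rewrite -eb; apply: sorts_foldr; rewrite -/b0 eb inversions_block.
Qed.

End SortingBits.

Section ReducedCrossing.
Variables i j : nat.
Let n := (i + j)%N.

Lemma chiE (r : 'I_n) :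
  chi i j r = (if (r < i)%N then (j + r)%N else (r - i)%N) :> nat.
Proof.
rewrite permE /block_swap /=; case: splitP => k /= ek; rewrite ek //.
by rewrite addKn.
Qed.

Lemma adj_transpE (k : 'I_n.-1) (r : 'I_n) : adj_transp k r = adj_swap k r :> nat.
Proof.
rewrite /adj_transp permE /= /adj_swap -!val_eqE /=.
by case: ifP => // _; case: ifP.
Qed.

Lemma foldr_adj_transp (ks : seq 'I_n.-1) (r : 'I_n) :
  foldr (fun k r' => adj_transp k r') r ks = foldr adj_swap r (map val ks) :> nat.
Proof. by elim: ks => //= k ks IH; rewrite adj_transpE IH. Qed.

(** Minimality is compared with [crossing i j], of length [i * j]. *)
Lemma reduced_word_sorts :
  sorts (map val (reduced_word (chi i j))) (nseq j true ++ nseq i false).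
Proof.
have [exp min] := reducedP (chi i j).
apply: sorts_crossing => [k /mapP[l _ ->]|r ltr|].
- by have := ltn_ord l; rewrite /n /=; lia.
- by rewrite -(foldr_adj_transp _ (Ordinal ltr)) -exp chiE.
have val_insub : map val (pmap (insub : nat -> option 'I_n.-1) (crossing i j)) = crossing i j.
  have ltn : all (fun k => k < n.-1)%N (crossing i j).
    by apply/allP => k /crossing_lt; rewrite /n; lia.
  rewrite -[RHS](all_filterP ltn) (pmap_filter (insubK _)).
  by apply: eq_filter => k; rewrite isSome_insub.
rewrite size_map -size_crossing -val_insub size_map; apply: min => r.
by apply: val_inj; rewrite /= foldr_adj_transp val_insub foldr_swap_crossing ?chiE.
Qed.

End ReducedCrossing.

(** * Axioms on tensor powers as relations between position operators *)

Section ThreeLetters.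
Variables (K : fieldType) (V : lmodType K).
Local Notation T := (tensor_algebra V).
Implicit Types (x y z t : T).

Definition word3 : (V ⊗ V) ⊗ V -> T :=
  @concat K V \o tensor_map (@word2 K V) (@letter K V).
HB.instance Definition _ := GRing.Linear.on word3.

Definition word3r : V ⊗ (V ⊗ V) -> T :=
  @concat K V \o tensor_map (@letter K V) (@word2 K V).
HB.instance Definition _ := GRing.Linear.on word3r.

Lemma word3E s c : word3 (s \ox c) = word2 s ** letter c.
Proof. by rewrite /word3 /= tensor_mapE. Qed.

Lemma word3rE c s : word3r (c \ox s) = letter c ** word2 s.
Proof. by rewrite /word3r /= tensor_mapE. Qed.

Lemma tensor3_ext (W : lmodType K) (f h : {linear (V ⊗ V) ⊗ V -> W}) :
  (forall a b c, f ((a \ox b) \ox c) = h ((a \ox b) \ox c)) -> f =1 h.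
Proof.
move=> fh; apply: tensor_ext => s c.
by apply: (tensor_ext (f := f \o purer c) (h := h \o purer c)) => a b; exact: fh.
Qed.

Lemma tensor3r_ext (W : lmodType K) (f h : {linear V ⊗ (V ⊗ V) -> W}) :
  (forall a b c, f (a \ox (b \ox c)) = h (a \ox (b \ox c))) -> f =1 h.
Proof.
move=> fh; apply: tensor_ext => a s.
by apply: (tensor_ext (f := f \o pure a) (h := h \o pure a)) => b c; exact: fh.
Qed.

Lemma word3r_assoc s : word3r (assoc s) = word3 s.
Proof.
apply: (tensor3_ext (f := word3r \o @assoc K V V V) (h := word3)) => a b c /=.
by rewrite assocE word3E word3rE !word2_pure catTA.
Qed.

Lemma assocVK s : assoc (assocV s) = s :> V ⊗ (V ⊗ V).
Proof.
apply: (tensor3r_ext (f := @assoc K V V V \o @assocV K V V V)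
  (h := @idfun (V ⊗ (V ⊗ V)))) => a b c /=.
by rewrite assocVE assocE.
Qed.

Lemma word3_assocV s : word3 (assocV s) = word3r s.
Proof. by rewrite -word3r_assoc assocVK. Qed.

Lemma hom_word3 s : hom 3 (word3 s).
Proof.
apply: (tensor3_ext (f := proj 3 \o word3) (h := word3)) => a b c /=.
by rewrite word3E; apply: (hom_cat (m := 2) (n := 1));
  [exact: hom_word2 | exact: hom_letter].
Qed.

Definition unword3 : T -> (V ⊗ V) ⊗ V :=
  word_lift (fun w => if w is [:: a; b; c] then (a \ox b) \ox c else 0).
HB.instance Definition _ := GRing.Linear.on unword3.

Lemma word3K : cancel word3 unword3.
Proof.
pose f : {linear (V ⊗ V) ⊗ V -> (V ⊗ V) ⊗ V} := unword3 \o word3.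
suff fK : f =1 @idfun ((V ⊗ V) ⊗ V) by exact: fK.
apply: (tensor3_ext (h := @idfun ((V ⊗ V) ⊗ V))) => a b c; rewrite /f /=.
rewrite word3E word2E cat_word /unword3 word_liftE //.
move=> [|x [|y [|z [|z' p]]]] k v v' [|x' [|y' [|z'' s]]] //=;
  by rewrite ?scaler0 ?addr0 ?purePl ?purePr ?purePl.
Qed.

Lemma word3_inj : injective word3.
Proof. exact: can_inj word3K. Qed.

Lemma word3r_inj : injective word3r.
Proof.
move=> s t; rewrite -!word3_assocV => /word3_inj e.
by rewrite -[s]assocVK -[t]assocVK e.
Qed.

Lemma word3_head a b c s :
  word [:: a, b, c & s] = word3 ((a \ox b) \ox c) ** word s.
Proof. by rewrite word3E word2E !cat_word. Qed.

Lemma word2_head (a b : V) s : word [:: a, b & s] = word2 (a \ox b) ** word s.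
Proof. by rewrite word2E !cat_word. Qed.

Section Ops.
Variables (S : {linear V ⊗ V -> V ⊗ V}) (D : {linear V -> V ⊗ V}).

Lemma at0_word2 s : at_ 0 (op22 S) (word2 s) = word2 (S s).
Proof. by rewrite at0E ?op22E //; exact: hom_word2. Qed.

Lemma at0_word3 s : at_ 0 (op22 S) (word3 s) = word3 (braid1 S s).
Proof.
apply: (tensor_ext (f := at_ 0 (op22 S) \o word3) (h := word3 \o braid1 S)) => r c /=.
rewrite word3E at0_cat ?op22E; last exact: hom_word2.
by rewrite /braid1 tensor_mapE word3E.
Qed.

Lemma at1_word3r s :
  at_ 1 (op22 S) (word3r s) = word3r (tensor_map idfun S s).
Proof.
apply: (tensor_ext (f := at_ 1 (op22 S) \o word3r)
                   (h := word3r \o tensor_map idfun S)) => a r /=.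
rewrite word3rE tensor_mapE word3rE (at_shift_cat (k := 1)); last exact: hom_letter.
by rewrite at0_word2.
Qed.

Lemma at1_word3 s : at_ 1 (op22 S) (word3 s) = word3 (braid2 S s).
Proof. by rewrite /braid2 /= word3_assocV -at1_word3r word3r_assoc. Qed.

Lemma at0_dup s : at_ 0 (op12 D) (word2 s) = word3 (tensor_map D idfun s).
Proof.
apply: (tensor_ext (f := at_ 0 (op12 D) \o @word2 K V)
                   (h := word3 \o tensor_map D idfun)) => a b /=.
rewrite tensor_mapE word3E word2_pure at0_cat ?op12E //; exact: hom_letter.
Qed.

Lemma at0_letter c : at_ 0 (op12 D) (letter c) = word2 (D c).
Proof. by rewrite at0E ?op12E //; exact: hom_letter. Qed.

Lemma at1_dup s : at_ 1 (op12 D) (word2 s) = word3r (tensor_map idfun D s).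
Proof.
apply: (tensor_ext (f := at_ 1 (op12 D) \o @word2 K V)
                   (h := word3r \o tensor_map idfun D)) => a b /=.
rewrite tensor_mapE word3rE word2_pure (at_shift_cat (k := 1)); last exact: hom_letter.
by rewrite at0_letter.
Qed.

Lemma eq_on_heads m (X Y : {linear T -> T}) :
    (forall n x, hom n x -> (n < m)%N -> X x = Y x) ->
    (forall w z, size w = m -> X (word w ** z) = Y (word w ** z)) ->
  X =1 Y.
Proof.
move=> XY0 XY; apply: word_ext => w.
case: (ltnP (size w) m) => szw; first by apply: (XY0 (size w)) => //; exact: hom_word.
by rewrite -(cat_take_drop m w) -cat_word XY // size_takel.
Qed.

End Ops.
End ThreeLetters.

Section Relations.
Variables (K : fieldType) (V : lmodType K).
Local Notation T := (tensor_algebra V).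
Variables (S : {linear V ⊗ V -> V ⊗ V}) (D : {linear V -> V ⊗ V}).
Local Notation s_ k := (at_ k (op22 S)).
Local Notation d_ k := (at_ k (op12 D)).
Implicit Types (x y z t : T).

Lemma at22_hom n k t : hom n t -> hom n (s_ k t).
Proof.
move=> ht; case: (ltnP n (k + 2)) => len; first by rewrite (at_short _ ht) //; exact: hom0.
by rewrite -(subnKC len); apply: at_hom; rewrite subnKC.
Qed.

Lemma at12_hom n k t : hom n t -> hom n.+1 (d_ k t).
Proof.
move=> ht; case: (ltnP n (k + 1)) => len; first by rewrite (at_short _ ht) //; exact: hom0.
have -> : n.+1 = (k + 2 + (n - (k + 1)))%N by lia.
by apply: at_hom; rewrite subnKC.
Qed.

(** The following four lemmas translate the axioms of a braided coalgebra into
    relations between position operators on [T(V)]. They are used from left to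
    right with [V = C], and from right to left with [V = T(C)]. *)
Lemma braid_relP :
  (forall r, braid1 S (braid2 S (braid1 S r)) = braid2 S (braid1 S (braid2 S r))) <->
  (forall k t, s_ k (s_ k.+1 (s_ k t)) = s_ k.+1 (s_ k (s_ k.+1 t))).
Proof.
split=> [H k t|H r]; last first.
  by apply: word3_inj; rewrite -!(at0_word3, at1_word3) H.
have E : s_ 0 \o s_ 1 \o s_ 0 =1 s_ 1 \o s_ 0 \o s_ 1.
  apply: (eq_on_heads (m := 3)) => [n x hx ltn|[|a [|b [|c []]]] // z _] /=.
    by rewrite (at_short (k := 1) _ hx) // linear0 (at_short (k := 1) _ (at22_hom 0 hx)) // !linear0.
  rewrite word3_head catT1.
  do !(rewrite (at_cat_left _ _ (hom_word3 _)) // ?at0_word3 ?at1_word3).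
  by rewrite H.
shift_relation E k t.
Qed.

Lemma dup_braid_lP :
  (forall r, tensor_map idfun D (S r) =
     assoc (braid1 S (braid2 S (tensor_map D idfun r)))) <->
  (forall k t, d_ k.+1 (s_ k t) = s_ k (s_ k.+1 (d_ k t))).
Proof.
split=> [H k t|H r]; last first.
  apply: word3r_inj; rewrite word3r_assoc -at0_word3 -at1_word3 -at0_dup.
  by rewrite -H at0_word2 at1_dup.
have E : d_ 1 \o s_ 0 =1 s_ 0 \o s_ 1 \o d_ 0.
  apply: (eq_on_heads (m := 2)) => [n x hx ltn|[|a [|b []]] // z _] /=.
    by rewrite (at_short (k := 1) _ (at12_hom 0 hx)) // (at_short (k := 0) _ hx) // !linear0.
  rewrite word2_head catT1.
  rewrite !(at_cat_left _ _ (hom_word2 _)) // at0_word2 at0_dup.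
  rewrite (at_cat_left _ _ (hom_word2 _)) // at1_dup H.
  by rewrite !(at_cat_left _ _ (hom_word3 _)) // at1_word3 (at_cat_left _ _ (hom_word3 _)) //
    at0_word3 word3r_assoc.
shift_relation E k t.
Qed.

Lemma dup_braid_rP :
  (forall r, tensor_map D idfun (S r) =
     braid2 S (braid1 S (assocV (tensor_map idfun D r)))) <->
  (forall k t, d_ k (s_ k t) = s_ k.+1 (s_ k (d_ k.+1 t))).
Proof.
split=> [H k t|H r]; last first.
  apply: word3_inj; rewrite -at1_word3 -at0_word3 word3_assocV -at1_dup.
  by rewrite -H at0_word2 at0_dup.
have E : d_ 0 \o s_ 0 =1 s_ 1 \o s_ 0 \o d_ 1.
  apply: (eq_on_heads (m := 2)) => [n x hx ltn|[|a [|b []]] // z _] /=.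
    by rewrite (at_short (k := 1) _ hx) // (at_short (k := 0) _ hx) // !linear0.
  rewrite word2_head catT1.
  rewrite !(at_cat_left _ _ (hom_word2 _)) // at0_word2 at1_dup -word3_assocV.
  rewrite (at_cat_left _ _ (hom_word2 _)) // at0_dup H.
  by rewrite !(at_cat_left _ _ (hom_word3 _)) // at0_word3 (at_cat_left _ _ (hom_word3 _)) //
    at1_word3.
shift_relation E k t.
Qed.

Lemma dup_coassocP :
  (forall c, assoc (tensor_map D idfun (D c)) = tensor_map idfun D (D c)) <->
  (forall k t, d_ k (d_ k t) = d_ k.+1 (d_ k t)).
Proof.
split=> [H k t|H c]; last first.
  by apply: word3r_inj; rewrite word3r_assoc -at1_dup -at0_dup -at0_letter H.
have E : d_ 0 \o d_ 0 =1 d_ 1 \o d_ 0.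
  apply: (eq_on_heads (m := 1)) => [n x hx ltn|[|a []] // z _] /=.
    by rewrite (at_short (k := 0) _ hx) // !linear0.
  rewrite -/(letter a) (at_cat_left _ _ (hom_letter _)) // at0_letter.
  by rewrite !(at_cat_left _ _ (hom_word2 _)) // at0_dup at1_dup -H word3r_assoc.
shift_relation E k t.
Qed.

Lemma at22_inv (S' : {linear V ⊗ V -> V ⊗ V}) : cancel S S' ->
  forall n k t, hom n t -> (k.+1 < n)%N -> at_ k (op22 S') (s_ k t) = t.
Proof.
move=> SK n k t ht ltk.
apply: (hom_ext (f := at_ k (op22 S') \o s_ k) (h := @idfun T) _ ht) => w sw /=.
rewrite -(cat_take_drop k w) -cat_word.
have hk : hom k (word (take k w)) by apply: hom_word; rewrite size_takel; lia.
rewrite -[k in at_ k]addn0 !at_shift_cat //; congr (_ ** _).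
case e: (drop k w) => [|a [|b s]]; try by have := size_drop k w; rewrite e /=; lia.
by rewrite word2_head !(at_cat_left _ _ (hom_word2 _)) // !at0_word2
  (at_cat_left _ _ (hom_word2 _)) // at0_word2 SK.
Qed.

End Relations.

(** * Block crossings of a braiding *)

Section CrossingOperators.
Variables (K : fieldType) (C : lmodType K).
Local Notation T := (tensor_algebra C).
Variable sigma : {linear C ⊗ C -> C ⊗ C}.
Local Notation s_ k := (at_ k (op22 sigma)).
Implicit Types (x y z t : T) (ks : seq nat).

Definition braid_along ks t : T := foldr (fun k t' => s_ k t') t ks.

Fact braid_along_linear ks : linear (braid_along ks).
Proof. by move=> a x y; elim: ks => //= k ks ->; rewrite linearP. Qed.
HB.instance Definition _ ks :=
  GRing.isLinear.Build K T T _ (braid_along ks) (braid_along_linear ks).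

Local Notation W := braid_along.

Lemma braid_along_cat ks ks' t : W (ks ++ ks') t = W ks (W ks' t).
Proof. exact: foldr_cat. Qed.

Lemma braid_along_hom n ks t : hom n t -> hom n (W ks t).
Proof. by move=> ht; elim: ks => //= k ks; exact: at22_hom. Qed.

Lemma braid_along_shift_cat n ks x y : hom n x ->
  W (map (addn n) ks) (x ** y) = x ** W ks y.
Proof. by move=> hx; elim: ks => //= k ks ->; rewrite at_shift_cat. Qed.

Lemma braid_along_cat_left n ks x y : (forall k, k \in ks -> (k.+1 < n)%N) ->
  hom n x -> W ks (x ** y) = W ks x ** y.
Proof.
move=> ltks hx; elim: ks ltks => //= k ks IH ltks.
rewrite IH => [|l lks]; last by apply: ltks; rewrite inE lks orbT.
rewrite (at_cat_left _ _ (braid_along_hom _ hx)) //.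
by have := ltks k (mem_head _ _); lia.
Qed.

Lemma braid_far k l t : (k.+1 < l)%N -> s_ k (s_ l t) = s_ l (s_ k t).
Proof. by move=> ltk; apply: at_comm; lia. Qed.

Lemma braid_along_far l ks t : (forall k, k \in ks -> (k.+1 < l)%N) ->
  s_ l (W ks t) = W ks (s_ l t).
Proof.
elim: ks => //= k ks IH ltks; rewrite -braid_far ?IH //; last first.
  by apply: ltks; rewrite mem_head.
by move=> m mks; apply: ltks; rewrite inE mks orbT.
Qed.

Lemma braid_along_comm ks ks' t :
    (forall k l, k \in ks -> l \in ks' -> (k.+1 < l)%N) ->
  W ks (W ks' t) = W ks' (W ks t).
Proof.
elim: ks' => //= l ks' IH lt; rewrite -braid_along_far ?IH //.
  by move=> k m kks mks; apply: lt; rewrite // inE mks orbT.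
by move=> k kks; apply: lt; rewrite // mem_head.
Qed.


Lemma map_addn_succ m ks : map (addn m) (map succn ks) = map (addn m.+1) ks.
Proof. by rewrite -map_comp; apply: eq_map => k /=; rewrite addnS. Qed.

Lemma map_addn0 ks : map (addn 0) ks = ks.
Proof. by rewrite -[RHS]map_id; apply: eq_map. Qed.

(** Passing over [j + l] letters is passing over [j], then over [l]. Unlike the
    decomposition [crossingDl] of the moving block, this is not an equality of
    words: the passes of different letters are interleaved, and far
    commutations are needed. The offset [m] is there for the induction. *)
Lemma braid_along_crossingDr m i j l t : W (map (addn m) (crossing i (j + l))) t =
  W (map (addn (m + j)) (crossing i l)) (W (map (addn m) (crossing i j)) t).
Proof.
elim: i m t => [|i IH] m t; first by [].
rewrite !(crossingS i) !map_cat !braid_along_cat !map_addn_succ IH passD map_cat.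
rewrite braid_along_cat -map_comp (@eq_map _ _ _ (addn (m + j))) => [|k /=]; last first.
  by rewrite addnA.
congr (W _ _); rewrite addSn braid_along_comm // => k k'.
case/mapP => q; rewrite mem_pass => ltq -> /mapP[q' _ ->].
by lia.
Qed.

Lemma braid_along_crossingDr0 i j l t : W (crossing i (j + l)) t =
  W (map (addn j) (crossing i l)) (W (crossing i j) t).
Proof. by have := braid_along_crossingDr 0 i j l t; rewrite add0n !map_addn0. Qed.

Section Braiding.
Hypothesis sigma_braid : forall k t, s_ k (s_ k.+1 (s_ k t)) = s_ k.+1 (s_ k (s_ k.+1 t)).

(** The single place where the braid relation is used: a crossing of two letters
    slides under a letter that passes over both. *)
Lemma pass_natural m n k t : (k.+1 < n)%N ->
  W (map (addn m) (pass n)) (s_ (m + k.+1) t) =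
  s_ (m + k) (W (map (addn m) (pass n)) t).
Proof.
elim: n => // n IH; rewrite ltnS leq_eqVlt => /orP[/eqP<-|ltk]; last first.
  by rewrite passS /= IH // -braid_far //; lia.
rewrite !passS /= addnS -braid_along_far ?sigma_braid // => l.
case/mapP => q; rewrite mem_pass => ltq ->.
by lia.
Qed.

Lemma crossing_natural m i n k t : (k.+1 < n)%N ->
  W (map (addn m) (crossing i n)) (s_ (m + i + k) t) =
  s_ (m + k) (W (map (addn m) (crossing i n)) t).
Proof.
move=> ltk; elim: i m => [|i IH] m; first by rewrite addn0.
rewrite (crossingS i) map_cat !braid_along_cat !map_addn_succ.
by rewrite addnS -addSn IH addSnnS pass_natural.
Qed.

Lemma crossing_natural_along i n ks t : (forall k, k \in ks -> (k.+1 < n)%N) ->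
  W (crossing i n) (W (map (addn i) ks) t) = W ks (W (crossing i n) t).
Proof.
elim: ks => //= k ks IH ltks.
have := crossing_natural 0 i (W (map (addn i) ks) t) (ltks k (mem_head _ _)).
rewrite !add0n map_addn0 => ->; rewrite IH // => l lks.
by apply: ltks; rewrite inE lks orbT.
Qed.

(** The braid relation for blocks of sizes [i], [j] and [l] is the naturality of
    the passage of the first block over the other two, with respect to the
    crossing of these two. *)
Lemma crossing_braid i j l t :
  W (crossing j l) (W (map (addn j) (crossing i l)) (W (crossing i j) t)) =
  W (map (addn l) (crossing i j)) (W (crossing i l) (W (map (addn i) (crossing j l)) t)).
Proof.
rewrite -braid_along_crossingDr0 -crossing_natural_along => [|k /crossing_lt //].
by rewrite addnC braid_along_crossingDr0.
Qed.

End Braiding.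

Section Coproduct.
Variable Delta : {linear C -> C ⊗ C}.
Local Notation d_ k := (at_ k (op12 Delta)).

(** Doubling a letter before or after it crosses a block: the two compatibility
    axioms of [Delta] and [sigma], iterated over the letters of the block. *)
Lemma dup_crossing_l j t :
    (forall k u, d_ k.+1 (s_ k u) = s_ k (s_ k.+1 (d_ k u))) ->
  d_ j (W (crossing 1 j) t) = W (crossing 2 j) (d_ 0 t).
Proof.
move=> H; rewrite crossing1; elim: j => [|j IH]; first by [].
have -> : W (crossing 2 j.+1) (d_ 0 t) = W (map (addn j) [:: 0; 1]) (W (crossing 2 j) (d_ 0 t)).
  by rewrite -[j.+1]addn1 braid_along_crossingDr0.
by rewrite passS /= H IH addn0 addn1.
Qed.

Lemma dup_crossing_r m i t :
    (forall k u, d_ k (s_ k u) = s_ k.+1 (s_ k (d_ k.+1 u))) ->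
  d_ m (W (map (addn m) (crossing i 1)) t) =
  W (map (addn m) (crossing i 2)) (d_ (m + i) t).
Proof.
move=> H; elim: i m t => [|i IH] m t; first by rewrite addn0.
rewrite !(crossingS i) !map_cat !map_addn_succ /= !addn0 addn1 H IH.
by rewrite addnS addSn.
Qed.

End Coproduct.

(** Independence of the reduced word for block transpositions. It holds for any
    linear [sigma], since only far commutations relate these words; in
    particular it applies to the inverse braiding. *)
Lemma braid_along_sorts i j ks t :
    sorts ks (nseq j true ++ nseq i false) ->
  W ks t = W (crossing i j) t.
Proof.
move=> sks; apply: (sorts_unique _ sks).
  by move=> k l x lt; exact: braid_far.
apply: sorts_crossing; first by move=> k /crossing_lt.
  exact: foldr_swap_crossing.
by rewrite size_crossing.
Qed.

Lemma braid_at_at n k t : hom n t -> (k.+1 < n)%N -> braid_at sigma k t = s_ k t.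
Proof.
move=> ht ltk; apply: (hom_ext (f := braid_at sigma k) (h := s_ k) _ ht) => w sw /=.
have [p [c [d [s [<- ->]]]]] : exists p c d s, size p = k /\ w = p ++ [:: c, d & s].
  exists (take k w), (nth 0 w k), (nth 0 w k.+1), (drop k.+2 w).
  rewrite size_takel; last by lia.
  by rewrite -!drop_nth ?cat_take_drop //; lia.
rewrite braid_atE -cat_word word2_head catTA at_cat; [|exact: hom_word|exact: hom_word2].
by rewrite op22E.
Qed.

Lemma braid_perm_crossing i j t : hom (i + j) t ->
  braid_perm sigma (chi i j) t = W (crossing i j) t.
Proof.
move=> ht; rewrite -(braid_along_sorts t (reduced_word_sorts i j)) /braid_perm.
elim: (reduced_word (chi i j)) => //= k ks ->.
by rewrite (@braid_at_at (i + j)) //; [exact: braid_along_hom | case: k => /= k; lia].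
Qed.

Lemma beta_crossing u v : beta sigma (word u \ox word v) =
  deconcat (size v) (W (crossing (size u) (size v)) (word u ** word v)).
Proof.
rewrite betaE /beta_word cat_word; case: nilP => [->|_] /=.
  by rewrite deconcatE take_size drop_size.
case: nilP => [->|_] /=; first by rewrite crossing0 deconcatE take0 drop0 cats0.
by rewrite braid_perm_crossing //; apply: hom_word; rewrite size_cat.
Qed.

End CrossingOperators.

(** * Cutting words into blocks *)

Section Cut.
Variables (K : fieldType) (C : lmodType K).
Local Notation T := (tensor_algebra C).
Local Notation TT := (tensor_algebra T).
Implicit Types (t : T) (ns : seq nat).

(** The first block has [n] letters, and [Z] treats the remaining ones. *)
Definition cons_block n (Z : {linear T -> TT}) : T -> TT :=
  @concat K T \o tensor_map (@letter K T \o @proj K C n) Z \o deconcat n.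
HB.instance Definition _ n Z := GRing.Linear.on (cons_block n Z).

Lemma cons_block_cat n (Z : {linear T -> TT}) x y : hom n x ->
  cons_block n Z (x ** y) = letter x ** Z y.
Proof. by move=> hx; rewrite /cons_block /= deconcat_hom // tensor_mapE /= hx. Qed.

Lemma cons_block_short m n (Z : {linear T -> TT}) t : hom m t -> (m < n)%N ->
  cons_block n Z t = 0.
Proof.
move=> ht ltm; apply: (hom_ext (f := cons_block n Z) (h := \0) _ ht) => w sw.
rewrite /= /cons_block /= deconcatE tensor_mapE /= projE ifF; last by rewrite size_take_min; lia.
by rewrite linear0 cat0T.
Qed.

Lemma cons_block_ext n (Z : {linear T -> TT}) (Z' : {linear T -> TT}) :
    (forall m t, hom m t -> (m < n)%N -> Z' t = 0) ->
    (forall x y, hom n x -> Z' (x ** y) = letter x ** Z y) ->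
  cons_block n Z =1 Z'.
Proof.
move=> Z'0 Z'E; apply: word_ext => w /=.
have hw : hom (size w) (word w) by apply: hom_word.
case: (ltnP (size w) n) => szw; first by rewrite (cons_block_short _ hw) ?(Z'0 _ _ hw).
have hx : hom n (word (take n w)) by apply: hom_word; rewrite size_takel.
by rewrite -(cat_take_drop n w) -cat_word cons_block_cat ?Z'E.
Qed.

Lemma eq_cons_block n (Z Z' : {linear T -> TT}) : Z =1 Z' ->
  cons_block n Z =1 cons_block n Z'.
Proof.
move=> ZZ'; apply: cons_block_ext => [m t|x y hx] /=; first exact: cons_block_short.
by rewrite cons_block_cat // ZZ'.
Qed.

Lemma cons_blockD n (Z Z' : {linear T -> TT}) t :
  cons_block n (Z \+ Z') t = cons_block n Z t + cons_block n Z' t.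
Proof.
apply: (cons_block_ext (Z' := cons_block n Z \+ cons_block n Z')) => [m u hu ltm|x y hx] /=.
  by rewrite !(cons_block_short _ hu) // addr0.
by rewrite !cons_block_cat //= !linearD.
Qed.

Lemma cons_block0 n t : cons_block n \0 t = 0.
Proof.
by apply: (cons_block_ext (Z' := \0)) => [|x y hx] //=; rewrite catT0.
Qed.

Lemma at_cons_block k a b (F : local_op T a b) n (Z : {linear T -> TT}) t :
  at_ k.+1 F (cons_block n Z t) = cons_block n (at_ k F \o Z) t.
Proof.
apply/esym/(cons_block_ext (Z' := at_ k.+1 F \o cons_block n Z)) => [m u hu ltm|x y hx] /=.
  by rewrite !(cons_block_short _ hu) // linear0.
by rewrite !cons_block_cat // (at_shift_cat (k := 1)) //; exact: hom_letter.
Qed.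

(** [cut ns] maps a word of length [sumn ns] to the word in [T(T(C))] of its
    consecutive blocks of sizes [ns], and other words to 0. The part of
    multidegree [ns] of a tensor power of [T(C)] is in this way a copy of the
    part of [T(C)] of degree [sumn ns], on which the operators [sigma_k] and
    [Delta_k] act; relations between operations on [T(C)] are read there. *)
Fixpoint cut_linear ns : {linear T -> TT} :=
  if ns is n :: ns' then cons_block n (cut_linear ns')
  else word_lift (fun w => if nilp w then word [::] else 0).
Definition cut ns : T -> TT := cut_linear ns.
HB.instance Definition _ ns := GRing.Linear.on (cut ns).

Lemma cut_block n ns t : cut (n :: ns) t = cons_block n (cut ns) t.
Proof. by []. Qed.

Lemma cut_cat n ns x y : hom n x -> cut (n :: ns) (x ** y) = letter x ** cut ns y.
Proof. exact: cons_block_cat. Qed.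

Lemma cut_nilE w : cut [::] (word w) = if nilp w then word [::] else 0.
Proof. by rewrite /cut /= word_liftE // => -[|d p] a c c' s /=; rewrite scaler0 addr0. Qed.

Lemma cut_hom0 ns n t : hom n t -> n != sumn ns -> cut ns t = 0.
Proof.
move=> ht nns; apply: (hom_ext (f := cut ns) (h := \0) _ ht) => w sw.
elim: ns n {t ht} w nns sw => [|m ns IH] n w nns sw.
  rewrite /= cut_nilE.
  by move: nns; rewrite -sw; case: w {sw}.
case: (ltnP n m) => ltnm.
  by rewrite /= cut_block (cons_block_short _ (hom_word sw)).
rewrite -(cat_take_drop m w) -cat_word /= cut_cat; last first.
  by apply: hom_word; rewrite size_takel ?sw.
by rewrite (IH (n - m)%N) ?size_drop ?sw ?catT0 //; move: nns => /=; lia.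
Qed.

Lemma hom_cut ns t : hom (size ns) (cut ns t).
Proof.
elim: ns t => [|n ns IH] t.
  apply: (word_ext (f := proj 0 \o cut [::]) (h := cut [::])) => w /=.
  by rewrite cut_nilE; case: nilP => _; [exact: hom_word | exact: hom0].
apply/esym/(cons_block_ext (Z := cut ns) (Z' := proj (size ns).+1 \o cut (n :: ns)))
  => [m x hx ltm|x y hx] /=.
  by rewrite cut_block (cons_block_short _ hx) ?linear0.
by rewrite cut_cat //; apply: (hom_cat (m := 1)); [exact: hom_letter | exact: IH].
Qed.

Lemma word_cut us : word (map (@word K C) us) = cut (map size us) (word (flatten us)).
Proof.
elim: us => [|u us IH]; first by rewrite cut_nilE.
by rewrite map_cons word_cons -cat_word cut_cat ?IH //; exact: hom_word.
Qed.

(** [T(T(C))] is spanned by the words whose letters are themselves words. *)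
Lemma word_tuple_ext (W : lmodType K) (f h : {linear TT -> W}) :
  (forall us, f (word (map (@word K C) us)) = h (word (map (@word K C) us))) -> f =1 h.
Proof.
move=> fh; apply: word_ext => w.
suff H us : f (word (map (@word K C) us ++ w)) = h (word (map (@word K C) us ++ w)).
  exact: (H [::]).
elim: w us => [|a w IH] us; first by rewrite cats0 fh.
rewrite -!cat_word !word_cons.
pose g : {linear T -> TT} := @concat K T \o pure (word (map (@word K C) us))
  \o @concat K T \o purer (word w) \o @letter K T.
apply: (word_ext (f := f \o g) (h := h \o g)) => u.
have := IH (rcons us u).
by rewrite map_rcons cat_rcons -!cat_word !word_cons.
Qed.

Lemma cut_ext (W : lmodType K) (f h : {linear TT -> W}) :
  (forall ns t, f (cut ns t) = h (cut ns t)) -> f =1 h.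
Proof. by move=> fh; apply: word_tuple_ext => us; rewrite word_cut. Qed.

Lemma at_cut_short k a b (F : local_op T a b) ns t : (size ns < k + a)%N ->
  at_ k F (cut ns t) = 0.
Proof. exact/at_short/hom_cut. Qed.

Definition concat_op : local_op T 2 1 := op21 (@concat K C).

Section Permute.
Variable sigma : {linear C ⊗ C -> C ⊗ C}.
Local Notation W := (braid_along sigma).

Definition beta_op : local_op T 2 2 := op22 (beta sigma).
Local Notation beta_ k := (at_ k beta_op).

Lemma cut_cat2 i j ns x y : hom (i + j) x ->
  cut (i :: j :: ns) (x ** y) = word2 (deconcat i x) ** cut ns y.
Proof.
move=> hx.
apply: (hom_ext (f := cut (i :: j :: ns) \o @concat K C \o purer y)
  (h := @concat K T \o purer (cut ns y) \o @word2 K T \o deconcat i) _ hx) => w sw.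
rewrite /= deconcatE /purer.
have hi : hom i (word (take i w)) by apply: hom_word; rewrite size_takel; lia.
have hj : hom j (word (drop i w)) by apply: hom_word; rewrite size_drop; lia.
rewrite -{1}(cat_take_drop i w) -cat_word -catTA cut_cat // cut_cat //.
by rewrite catTA word2_pure.
Qed.

Lemma beta0_cut i j ns t :
  beta_ 0 (cut [:: i, j & ns] t) = cut [:: j, i & ns] (W (crossing i j) t).
Proof.
apply: (word_ext (f := beta_ 0 \o cut [:: i, j & ns])
                 (h := cut [:: j, i & ns] \o W (crossing i j))) => w.
rewrite [LHS]/= [RHS]/=.
have hw : hom (size w) (word w) by apply: hom_word.
have [szw|szw] := eqVneq (size w) (i + (j + sumn ns))%N; last first.
  by rewrite (cut_hom0 hw) ?linear0 // (cut_hom0 (braid_along_hom _ _ hw)) //=; lia.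
rewrite -(cat_take_drop (i + j) w) -cat_word.
set x := take _ w; have sx : size x = (i + j)%N by rewrite size_takel; lia.
have hx : hom (i + j) (word x) by apply: hom_word.
rewrite cut_cat2 // at0_cat ?op22E; last exact: hom_word2.
rewrite (braid_along_cat_left _ _ (@crossing_lt i j) hx).
rewrite cut_cat2; last by rewrite addnC; apply: braid_along_hom.
rewrite deconcatE /= beta_crossing cat_word cat_take_drop size_drop size_takel; last by lia.
by rewrite sx addKn.
Qed.

Lemma concat0_cut i j ns t :
  at_ 0 concat_op (cut [:: i, j & ns] t) = cut ((i + j)%N :: ns) t.
Proof.
apply: (word_ext (f := at_ 0 concat_op \o cut [:: i, j & ns])
                 (h := cut ((i + j)%N :: ns))) => w.
rewrite [LHS]/= [RHS]/=.
have hw : hom (size w) (word w) by apply: hom_word.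
have [szw|szw] := eqVneq (size w) (i + (j + sumn ns))%N; last first.
  by rewrite (cut_hom0 hw) ?linear0 // (cut_hom0 hw) //=; lia.
rewrite -(cat_take_drop (i + j) w) -cat_word.
set x := take _ w; have sx : size x = (i + j)%N by rewrite size_takel; lia.
have hx : hom (i + j) (word x) by apply: hom_word.
rewrite cut_cat2 // at0_cat ?op21E; last exact: hom_word2.
by rewrite cut_cat // deconcatE /= cat_word cat_take_drop.
Qed.

Lemma braid_along_block n ns ks t :
  cons_block n (cut ns \o W ks) t = cut (n :: ns) (W (map (addn n) ks) t).
Proof.
apply: (cons_block_ext (Z' := cut (n :: ns) \o W (map (addn n) ks))) => [m x hx ltm|x y hx] /=.
  by rewrite (cut_hom0 (braid_along_hom _ _ hx)) //=; lia.
by rewrite braid_along_shift_cat // cut_cat.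
Qed.

Lemma beta1_cut n i j ns t : beta_ 1 (cut [:: n, i, j & ns] t) =
  cut [:: n, j, i & ns] (W (map (addn n) (crossing i j)) t).
Proof.
rewrite cut_block at_cons_block -braid_along_block.
by apply: eq_cons_block => u; exact: beta0_cut.
Qed.

Lemma concat1_cut n i j ns t :
  at_ 1 concat_op (cut [:: n, i, j & ns] t) = cut [:: n, (i + j)%N & ns] t.
Proof.
rewrite cut_block at_cons_block cut_block.
by apply: eq_cons_block => u; exact: concat0_cut.
Qed.

End Permute.

End Cut.

Opaque cut.

(** * Degree, augmentation and generating coproduct of a block *)

Section Heads.
Variables (K : fieldType) (C : lmodType K).
Local Notation T := (tensor_algebra C).
Local Notation TT := (tensor_algebra T).
Implicit Types (t : T) (ns : seq nat).

Lemma cut_head m ns (W : lmodType K) (Z : {linear TT -> W}) (Z' : {linear T -> W}) :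
    (forall j t, hom j t -> (j < m)%N -> Z' t = 0) ->
    (forall u y, size u = m -> Z (letter (word u) ** cut ns y) = Z' (word u ** y)) ->
  forall t, Z (cut (m :: ns) t) = Z' t.
Proof.
move=> Z'0 ZE; apply: (word_ext (f := Z \o cut (m :: ns))) => w /=.
have hw : hom (size w) (word w) by apply: hom_word.
case: (ltnP (size w) m) => szw.
  by rewrite cut_block (cons_block_short _ hw) // linear0 (Z'0 _ _ hw).
have sx : size (take m w) = m by rewrite size_takel.
rewrite -(cat_take_drop m w) -cat_word cut_cat; last exact: hom_word.
exact: ZE.
Qed.

Lemma cut_head_short m ns j t : hom j t -> (j < m)%N -> cut (m :: ns) t = 0.
Proof. by move=> ht ltj; rewrite cut_block (cons_block_short _ ht). Qed.

Section Degree.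
Variable n : nat.

Definition degree_op : local_op T 1 1 := op11 (@proj K C n).
Local Notation p_ k := (at_ k degree_op).

Lemma degree0_cut m ns t :
  p_ 0 (cut (m :: ns) t) = if m == n then cut (m :: ns) t else 0.
Proof.
have pE u x : p_ 0 (letter (word u) ** x) = letter (proj n (word u)) ** x.
  by rewrite at0_cat ?op11E //; exact: hom_letter.
case: eqP => [->|nmn].
  apply: (cut_head (Z := p_ 0) (Z' := cut (n :: ns))); first exact: cut_head_short.
  by move=> u y su /=; rewrite pE projE su eqxx cut_cat //; exact: hom_word.
apply: (cut_head (Z := p_ 0) (Z' := \0)) => // u y su /=.
by rewrite pE projE su; case: eqP => // _; rewrite linear0 cat0T.
Qed.

Lemma degree1_cut l m ns t :
  p_ 1 (cut (l :: m :: ns) t) = if m == n then cut (l :: m :: ns) t else 0.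
Proof.
have H := degree0_cut m ns.
rewrite cut_block at_cons_block; case: eqP H => [-> H|_ H].
  exact: eq_cons_block.
by rewrite -(cons_block0 l t); apply: eq_cons_block.
Qed.
End Degree.

Section Counit.

Definition augmentation : T -> K^o := word_lift (fun w => if nilp w then 1 : K^o else 0).
HB.instance Definition _ := GRing.Linear.on augmentation.

Definition counit_op : local_op T 1 0 := op10 augmentation.
Local Notation e_ k := (at_ k counit_op).

Lemma augmentationE w : augmentation (word w) = if nilp w then 1 : K^o else 0.
Proof. by rewrite /augmentation word_liftE // => -[|d p] a c c' s /=; rewrite scaler0 addr0. Qed.

Lemma counit0_cut m ns t : e_ 0 (cut (m :: ns) t) = if m == 0 then cut ns t else 0.
Proof.
have eE u x : e_ 0 (letter (word u) ** x) = if nilp u then x else 0.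
  rewrite at0_cat ?op10E; last exact: hom_letter.
  rewrite /= augmentationE; case: nilP => _; first by rewrite scale1r cat1T.
  by rewrite scale0r cat0T.
case: eqP => [->|nm0].
  apply: (cut_head (Z := e_ 0) (Z' := cut ns)) => // u y su /=.
  by rewrite eE /nilp su (size0nil su) cat1T.
apply: (cut_head (Z := e_ 0) (Z' := \0)) => // u y su /=.
by rewrite eE /nilp su; case: eqP.
Qed.

Lemma counit1_cut l m ns t :
  e_ 1 (cut (l :: m :: ns) t) = if m == 0 then cut (l :: ns) t else 0.
Proof.
have H := counit0_cut m ns.
rewrite cut_block at_cons_block; case: eqP H => [-> H|_ H].
  exact: eq_cons_block.
by rewrite -(cons_block0 l t); apply: eq_cons_block.
Qed.
End Counit.

Lemma dup0_unit (D : {linear T -> T ⊗ T}) ns t :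
    D (word [::]) = word [::] \ox word [::] ->
  at_ 0 (op12 D) (cut (0 :: ns)%N t) = cut [:: 0, 0 & ns]%N t.
Proof.
move=> D1; apply: (cut_head (Z := at_ 0 (op12 D)) (Z' := cut [:: 0, 0 & ns]%N)) => // u y.
move=> /size0nil -> /=; rewrite at0_cat ?op12E; last exact: hom_letter.
by rewrite D1 cut_cat2 ?deconcatE //; exact: hom_word.
Qed.

Section Phi.
Variable Delta : {linear C -> C ⊗ C}.
Local Notation d_ k := (at_ k (op12 Delta)).

(** The map [phi], extended by [1 |-> 1 (x) 1] and by 0 on longer words. With the
    value at 1 included, the three terms of [phi] behave as one operation: it is
    coassociative and compatible with [beta], as [Delta] is with [sigma]. *)
Definition phi_ext : T -> T ⊗ T := word_lift (fun w =>
  match w with [::] => word [::] \ox word [::] | [:: c] => phi Delta c | _ => 0 end).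
HB.instance Definition _ := GRing.Linear.on phi_ext.

Definition phi_op : local_op T 1 2 := op12 phi_ext.
Local Notation f_ k := (at_ k phi_op).

Lemma phi_extE w : phi_ext (word w) =
  match w with [::] => word [::] \ox word [::] | [:: c] => phi Delta c | _ => 0 end.
Proof.
rewrite /phi_ext word_liftE // => -[|d [|e p]] a c c' [|g s] //=;
  by rewrite ?scaler0 ?addr0 ?linearP.
Qed.

Lemma phi_head u x : f_ 0 (letter (word u) ** x) = word2 (phi_ext (word u)) ** x.
Proof. by rewrite at0_cat ?op12E //; exact: hom_letter. Qed.

Lemma phi0_cut0 ns t : f_ 0 (cut (0 :: ns)%N t) = cut [:: 0, 0 & ns]%N t.
Proof. by apply: dup0_unit; rewrite /= phi_extE. Qed.

Lemma phi0_cut1 ns t : f_ 0 (cut (1 :: ns)%N t) =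
  cut [:: 0, 1 & ns]%N t + cut [:: 1, 0 & ns]%N t + cut [:: 1, 1 & ns]%N (d_ 0 t).
Proof.
apply: (cut_head (Z := f_ 0) (Z' := cut [:: 0, 1 & ns]%N \+ cut [:: 1, 0 & ns]%N
  \+ (cut [:: 1, 1 & ns]%N \o d_ 0))) => [j x hx ltj|[|c []] // y _] /=.
  by rewrite (at_short _ hx) // !(cut_hom0 hx) ?linear0 ?addr0 //=; lia.
rewrite phi_head phi_extE -/(letter c) at0_cat ?op12E; last exact: hom_letter.
rewrite !cut_cat2 //; [|exact: hom_word2|exact: hom_letter..].
rewrite !deconcatE /= /phi !linearD /= !catDl.
congr (_ + _ + _); congr (word2 _ ** _).
have : deconcat 1 \o @word2 K C =1 tensor_map (@letter K C) (@letter K C).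
  by apply: tensor_ext => a b /=; rewrite word2E deconcatE tensor_mapE.
by move=> <-.
Qed.

Lemma phi0_cut2 n ns t : f_ 0 (cut (n.+2 :: ns) t) = 0.
Proof.
apply: (cut_head (Z := f_ 0) (Z' := \0)) => // -[|c [|d u]] //= y _.
by rewrite phi_head phi_extE linear0 cat0T.
Qed.

Lemma phi1_cut0 m ns t : f_ 1 (cut [:: m, 0 & ns]%N t) = cut [:: m, 0, 0 & ns]%N t.
Proof.
by rewrite cut_block at_cons_block; apply: eq_cons_block => u; exact: phi0_cut0.
Qed.

Lemma phi1_cut1 m ns t : f_ 1 (cut [:: m, 1 & ns]%N t) =
  cut [:: m, 0, 1 & ns]%N t + cut [:: m, 1, 0 & ns]%N t + cut [:: m, 1, 1 & ns]%N (d_ m t).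
Proof.
rewrite cut_block at_cons_block.
transitivity (cons_block m (cut [:: 0, 1 & ns]%N \+ cut [:: 1, 0 & ns]%N
  \+ (cut [:: 1, 1 & ns]%N \o d_ 0)) t).
  by apply: eq_cons_block => u; exact: phi0_cut1.
rewrite !cons_blockD; congr (_ + _).
apply: (cons_block_ext (Z' := cut [:: m, 1, 1 & ns]%N \o d_ m)) => [j x hx ltj|x y hx] /=.
  by rewrite (at_short _ hx) ?linear0 //; lia.
have -> : d_ m (x ** y) = x ** d_ 0 y by rewrite -{1}[m]addn0 at_shift_cat.
by rewrite cut_cat.
Qed.

Lemma phi1_cut2 m n ns t : f_ 1 (cut [:: m, n.+2 & ns] t) = 0.
Proof.
rewrite cut_block at_cons_block -(cons_block0 m t).
by apply: eq_cons_block => u; exact: phi0_cut2.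
Qed.

End Phi.
End Heads.

Opaque op10 op11 op12 op21 op22 augmentation phi_ext.

(** * Relations between the operations of T(C) *)

Section Diagrams.
Variables (K : fieldType) (C : lmodType K).
Variables (Delta : {linear C -> C ⊗ C}) (sigma : {linear C ⊗ C -> C ⊗ C}).
Local Notation T := (tensor_algebra C).
Local Notation TT := (tensor_algebra T).
Local Notation W := (braid_along sigma).
Local Notation s_ k := (at_ k (op22 sigma)).
Local Notation d_ k := (at_ k (op12 Delta)).
Local Notation B := (beta_op sigma).
Local Notation M := (concat_op C).
Local Notation F := (phi_op Delta).
Local Notation P n := (degree_op C n).
Local Notation E := (counit_op C).
Local Notation b k := (at_ k B).
Local Notation m k := (at_ k M).
Local Notation f k := (at_ k F).
Local Notation p n k := (at_ k (P n)).
Local Notation e k := (at_ k E).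
Implicit Types (t : TT).

Hypothesis sigma_braid :
  forall k x, s_ k (s_ k.+1 (s_ k x)) = s_ k.+1 (s_ k (s_ k.+1 x)).
Hypothesis dup_l : forall k x, d_ k.+1 (s_ k x) = s_ k (s_ k.+1 (d_ k x)).
Hypothesis dup_r : forall k x, d_ k (s_ k x) = s_ k.+1 (s_ k (d_ k.+1 x)).
Hypothesis dup_coassoc : forall k x, d_ k (d_ k x) = d_ k.+1 (d_ k x).

Let cutE := (beta0_cut, beta1_cut, concat0_cut, concat1_cut).

(** Both sides of a relation on three letters are computed on a cut: they vanish
    if it has fewer than three blocks. *)
Ltac cut_cases ns u :=
  apply: cut_ext => -[|? [|? [|? ns]]] u /=;
  rewrite ?cutE ?at_cut_short ?at_zero //= ?cutE ?at_cut_short ?at_zero //.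

Lemma beta_braid k t : b k (b k.+1 (b k t)) = b k.+1 (b k (b k.+1 t)).
Proof.
have H : b 0 \o b 1 \o b 0 =1 b 1 \o b 0 \o b 1.
  cut_cases ns u.
  by rewrite crossing_braid.
shift_relation H k t.
Qed.

Lemma concat_assoc k t : m k (m k.+1 t) = m k (m k t).
Proof.
have H : m 0 \o m 1 =1 m 0 \o m 0.
  by cut_cases ns u; rewrite addnA.
shift_relation H k t.
Qed.

Lemma beta_concat_l k t : b k (m k t) = m k.+1 (b k (b k.+1 t)).
Proof.
have H : b 0 \o m 0 =1 m 1 \o b 0 \o b 1.
  cut_cases ns u.
  by rewrite crossingDl braid_along_cat.
shift_relation H k t.
Qed.

Lemma beta_concat_r k t : b k (m k.+1 t) = m k (b k.+1 (b k t)).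
Proof.
have H : b 0 \o m 1 =1 m 0 \o b 1 \o b 0.
  cut_cases ns u.
  by rewrite braid_along_crossingDr0.
shift_relation H k t.
Qed.

Lemma beta_degree_l n k t : b k (p n k t) = p n k.+1 (b k t).
Proof.
have H : b 0 \o p n 0 =1 p n 1 \o b 0.
  apply: cut_ext => -[|i [|j ns]] u /=.
  - by rewrite !at_cut_short ?at_zero.
  - by rewrite degree0_cut (at_cut_short B) // at_zero; case: ifP; rewrite ?at_zero // at_cut_short.
  - by rewrite degree0_cut beta0_cut degree1_cut; case: ifP; rewrite ?at_zero // beta0_cut.
shift_relation H k t.
Qed.

Lemma beta_degree_r n k t : b k (p n k.+1 t) = p n k (b k t).
Proof.
have H : b 0 \o p n 1 =1 p n 0 \o b 0.
  apply: cut_ext => -[|i [|j ns]] u /=.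
  - by rewrite !at_cut_short ?at_zero.
  - by rewrite !at_cut_short ?at_zero.
  - by rewrite degree1_cut beta0_cut degree0_cut; case: ifP; rewrite ?at_zero // beta0_cut.
shift_relation H k t.
Qed.

Let fE := (phi0_cut0, phi0_cut1, phi0_cut2, phi1_cut0, phi1_cut1, phi1_cut2).

(** On a block of size 0 these hold because 1 crosses trivially; on a block of
    size 1 the term [Delta] of [phi] is governed by [dup_crossing_l] and
    [dup_crossing_r]; on larger blocks both sides vanish. *)
Lemma phi_beta_l k t : f k.+1 (b k t) = b k (b k.+1 (f k t)).
Proof.
have H : f 1 \o b 0 =1 b 0 \o b 1 \o f 0.
  apply: cut_ext => -[|i [|j ns]] u /=.
  - by rewrite !at_cut_short ?at_zero.
  - rewrite (at_cut_short B) // at_zero; case: i => [|[|i]]; rewrite fE.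
    + by rewrite (at_cut_short (k := 1)) ?at_zero.
    + by rewrite !at_add !(at_cut_short (k := 1)) // !at_zero !addr0.
    + by rewrite !at_zero.
  rewrite beta0_cut; case: i => [|[|i]].
  - by rewrite !fE beta1_cut beta0_cut.
  - rewrite !fE !at_add !beta1_cut !beta0_cut !map_addn0; congr (_ + _ + cut _ _).
    by rewrite dup_crossing_l // -braid_along_cat -(crossingDl 1 1).
  - by rewrite !fE !at_zero.
shift_relation H k t.
Qed.

Lemma phi_beta_r k t : f k (b k t) = b k.+1 (b k (f k.+1 t)).
Proof.
have H : f 0 \o b 0 =1 b 1 \o b 0 \o f 1.
  apply: cut_ext => -[|i [|j ns]] u /=.
  - by rewrite !at_cut_short ?at_zero.
  - by rewrite (at_cut_short B) // (at_cut_short F) // !at_zero.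
  rewrite beta0_cut; case: j => [|[|j]].
  - by rewrite !fE beta0_cut beta1_cut crossing0.
  - rewrite !fE !at_add !beta0_cut !beta1_cut !map_addn0 crossing0 /=.
    congr (_ + _ + cut _ _).
    have := dup_crossing_r 0 i u dup_r; rewrite !map_addn0 => ->.
    exact: (braid_along_crossingDr0 sigma i 1 1).
  - by rewrite !fE !at_zero.
shift_relation H k t.
Qed.

Lemma phi_coassoc k t : f k (f k t) = f k.+1 (f k t).
Proof.
have H : f 0 \o f 0 =1 f 1 \o f 0.
  apply: cut_ext => -[|[|[|i]] ns] u /=.
  - by rewrite !at_cut_short ?at_zero.
  - by rewrite !fE.
  - rewrite !fE !at_add !fE !addrA dup_coassoc.
    by rewrite [LHS](ACl (1*2*5*3*6*4*7)).
  - by rewrite !fE !at_zero.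
shift_relation H k t.
Qed.

Lemma counit_beta_l k t : e k (b k t) = e k.+1 t.
Proof.
have H : e 0 \o b 0 =1 e 1.
  apply: cut_ext => -[|i [|[|j] ns]] u /=.
  - by rewrite !at_cut_short ?at_zero.
  - by rewrite !at_cut_short ?at_zero.
  - by rewrite beta0_cut counit0_cut counit1_cut crossing0.
  - by rewrite beta0_cut counit0_cut counit1_cut.
shift_relation H k t.
Qed.

(** Without [m 0] this fails on words of two letters, which [e 1] does not
    annihilate. *)
Lemma concat_counit_beta t : m 0 (e 2 (b 1 t)) = m 0 (e 1 t).
Proof.
have e2_cut i j l ns u : e 2 (cut [:: i, j, l & ns] u) = if l == 0 then cut [:: i, j & ns] u else 0.
  rewrite cut_block at_cons_block -(cons_block0 i u) cut_block.
  rewrite -(fun_if (fun Z => cons_block i Z u)).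
  by apply: eq_cons_block => v /=; rewrite counit1_cut; case: ifP.
have H : m 0 \o e 2 \o b 1 =1 m 0 \o e 1.
  apply: cut_ext => -[|i [|j [|l ns]]] u /=.
  - by rewrite !at_cut_short ?at_zero.
  - by rewrite !at_cut_short ?at_zero.
  - rewrite (at_cut_short B) // !at_zero counit1_cut.
    by case: ifP; rewrite ?at_cut_short ?at_zero.
  - by rewrite beta1_cut e2_cut counit1_cut; case: j => [|j]; rewrite ?crossing0.
exact: H.
Qed.

Lemma counit_concat k t : e k (m k t) = e k (e k t).
Proof.
have H : e 0 \o m 0 =1 e 0 \o e 0.
  apply: cut_ext => -[|i [|j ns]] u /=.
  - by rewrite !at_cut_short ?at_zero.
  - by rewrite (at_cut_short M) // counit0_cut; case: ifP; rewrite ?at_zero ?at_cut_short.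
  - rewrite concat0_cut !counit0_cut addn_eq0; case: eqP => _ //=; last by rewrite at_zero.
    by rewrite counit0_cut.
shift_relation H k t.
Qed.

Lemma counit_phi_l t : e 0 (f 0 (p 1 0 t)) = p 1 0 t.
Proof.
have H : e 0 \o f 0 \o p 1 0 =1 p 1 0.
  apply: cut_ext => -[|i ns] u /=; first by rewrite !at_cut_short ?at_zero.
  rewrite degree0_cut; case: eqP => [->|_]; last by rewrite !at_zero.
  by rewrite !fE !at_add !counit0_cut /= !addr0.
exact: H.
Qed.

Lemma counit_phi_r t : e 1 (f 0 (p 1 0 t)) = p 1 0 t.
Proof.
have H : e 1 \o f 0 \o p 1 0 =1 p 1 0.
  apply: cut_ext => -[|i ns] u /=; first by rewrite !at_cut_short ?at_zero.
  rewrite degree0_cut; case: eqP => [->|_]; last by rewrite !at_zero.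
  by rewrite !fE !at_add !counit1_cut /= add0r addr0.
exact: H.
Qed.

(** [m 1 (m 0 (b 1 (f 0 _)))] is the left multiplication of [T(C) (x) T(C)] by
    [phi c]. The following two lemmas move an element of [T(C)] past its result,
    and the third one is its compatibility with the product of
    [T(C) (x) T(C)]. Each proof brings the products to the left and [phi] to the
    right, after which two braids remain to be compared. *)
Lemma slide_left t :
  m 2 (m 1 (b 2 (f 1 (b 0 (b 1 (b 2 t)))))) = b 0 (b 1 (m 1 (m 0 (b 1 (f 0 t))))).
Proof.
rewrite phi_beta_l (at_comm F B 0 1 2) // (at_comm F B 0 2 3) // -(at_comm B B 0 2 2) //.
rewrite beta_concat_l (at_comm B M 0 2 2) // -(at_comm M B 0 3 2) // -(at_comm M B 0 2 1) //.
rewrite beta_concat_l; congr (m 2 (m 1 (b 0 _))).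
by rewrite -beta_braid (at_comm B B 1 3 3).
Qed.

Lemma slide_right t :
  m 1 (m 0 (b 1 (f 0 (b 2 (b 1 (b 0 t)))))) = b 1 (b 0 (m 2 (m 1 (b 2 (f 1 t))))).
Proof.
rewrite (at_comm F B 0 2 3) // (at_comm F B 0 1 2) // phi_beta_r.
rewrite (at_comm B M 0 2 2) // beta_concat_r beta_concat_r -(at_comm M B 0 2 1) // -(at_comm M B 0 3 2) //.
congr (m 1 (m 0 _)).
by rewrite (at_comm B B 1 3 3) // beta_braid (at_comm B B 0 2 2).
Qed.

Lemma product_assoc t : m 1 (m 0 (b 1 (f 0 (m 2 (m 1 (b 2 t)))))) =
  m 1 (m 0 (b 1 (m 1 (m 0 (b 1 (f 0 t)))))).
Proof.
rewrite (at_comm F M 0 2 3) // (at_comm F M 0 1 2) // (at_comm F B 0 2 3) //.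
rewrite (at_comm B M 1 3 3) // beta_concat_r (at_comm M M 0 3 2) // concat_assoc concat_assoc.
rewrite beta_concat_l -(at_comm M M 0 2 1) // -(at_comm M B 0 3 2) // -(at_comm M B 0 2 1) //.
by rewrite (at_comm B B 1 3 3).
Qed.

End Diagrams.

(** * The algebra map Phi *)

Section PhiMap.
Variables (K : fieldType) (C : lmodType K).
Variables (Delta : {linear C -> C ⊗ C}) (sigma : {linear C ⊗ C -> C ⊗ C}).
Local Notation T := (tensor_algebra C).
Local Notation TT := (tensor_algebra T).
Local Notation B := (beta_op sigma).
Local Notation M := (concat_op C).
Local Notation F := (phi_op Delta).
Local Notation P n := (degree_op C n).
Local Notation b k := (at_ k B).
Local Notation m k := (at_ k M).
Local Notation f k := (at_ k F).
Local Notation p n k := (at_ k (P n)).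
Local Notation prod2 := (braided_product (@concat K C) (beta sigma)).
Implicit Types (t : TT).


Lemma braided_product_pure (x y x' y' : T) : prod2 ((x \ox y) \ox (x' \ox y')) =
  tensor_map (@concat K C) (@concat K C)
    (assocV (x \ox assoc (beta sigma (y \ox x') \ox y'))).
Proof.
by rewrite /braided_product /braid_middle /= assocE tensor_mapE /= assocVE tensor_mapE.
Qed.

Lemma braided_product_diagram s r z :
  m 1 (m 0 (b 1 (word2 s ** word2 r ** z))) = word2 (prod2 (s \ox r)) ** z.
Proof.
apply: (tensor_ext (f := m 1 \o m 0 \o b 1 \o @concat K T \o purer z \o @concat K T
                         \o purer (word2 r) \o @word2 K T)
  (h := @concat K T \o purer z \o @word2 K T \o prod2 \o purer r)) => x y.
rewrite [LHS]/= [RHS]/= /purer.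
apply: (tensor_ext (f := m 1 \o m 0 \o b 1 \o @concat K T \o purer z \o @concat K T
                         \o pure (word2 (x \ox y)) \o @word2 K T)
  (h := @concat K T \o purer z \o @word2 K T \o prod2 \o pure (x \ox y))) => x' y'.
rewrite [LHS]/= [RHS]/= /purer braided_product_pure.
have -> : word2 (x \ox y) ** word2 (x' \ox y') ** z =
    letter x ** word2 (y \ox x') ** (letter y' ** z).
  by rewrite !word2_pure !catTA.
rewrite at_cat ?op22E; [|exact: hom_letter|exact: hom_word2].
apply: (tensor_ext (f := m 1 \o m 0 \o @concat K T \o purer (letter y' ** z)
    \o @concat K T \o pure (letter x) \o @word2 K T)
  (h := @concat K T \o purer z \o @word2 K T \o tensor_map (@concat K C) (@concat K C)
    \o @assocV K T T (T ⊗ T) \o pure x \o @assoc K T T T \o purer y')) => x1 y1.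
rewrite [LHS]/= [RHS]/= /purer assocE assocVE tensor_mapE.
have -> : letter x ** word2 (x1 \ox y1) ** (letter y' ** z) =
    word2 (x \ox x1) ** (word2 (y1 \ox y') ** z).
  by rewrite !word2_pure !catTA.
rewrite at0_cat ?op21E; last exact: hom_word2.
rewrite catTA at_cat ?op21E; [|exact: hom_letter|exact: hom_word2].
by rewrite word2_pure.
Qed.

Definition Phi_word (u : seq C) : T ⊗ T :=
  foldr (fun c r => prod2 (phi Delta c \ox r)) (word [::] \ox word [::]) u.

Definition Phi : T -> T ⊗ T := word_lift Phi_word.
HB.instance Definition _ := GRing.Linear.on Phi.

Lemma PhiE u : Phi (word u) = Phi_word u.
Proof.
rewrite /Phi word_liftE // => q a c c' s; rewrite /Phi_word !foldr_cat /=.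
elim: q => [|d q IH] /=; last by rewrite IH; exact: (linearP (prod2 \o pure (phi Delta d))).
set r := foldr _ _ s; exact: (linearP (prod2 \o purer r \o phi Delta)).
Qed.

Lemma Phi_cons c u : Phi (word (c :: u)) = prod2 (phi Delta c \ox Phi (word u)).
Proof. by rewrite !PhiE. Qed.

Lemma Phi_nil : Phi (word [::]) = word [::] \ox word [::].
Proof. by rewrite PhiE. Qed.

Lemma prod2_unitr r : prod2 (r \ox (word [::] \ox word [::])) = r.
Proof.
apply: (tensor_ext (f := prod2 \o purer (word [::] \ox word [::]))
  (h := @idfun (T ⊗ T))) => x y.
rewrite [LHS]/= [RHS]/= /purer braided_product_pure.
have -> : beta sigma (y \ox word [::]) = word [::] \ox y.
  apply: (word_ext (f := beta sigma \o purer (word [::])) (h := pure (word [::]))) => u /=.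
  by rewrite /purer betaE /beta_word /= orbT.
by rewrite assocE assocVE tensor_mapE /= !catT1.
Qed.

Lemma prod2_unitl r : prod2 ((word [::] \ox word [::]) \ox r) = r.
Proof.
apply: (tensor_ext (f := prod2 \o pure (word [::] \ox word [::]))
  (h := @idfun (T ⊗ T))) => x y.
rewrite [LHS]/= [RHS]/= braided_product_pure.
have -> : beta sigma (word [::] \ox x) = x \ox word [::].
  apply: (word_ext (f := beta sigma \o pure (word [::])) (h := purer (word [::]))) => u /=.
  by rewrite betaE /beta_word.
by rewrite assocE assocVE tensor_mapE /= !cat1T.
Qed.

Lemma Phi_letter c : Phi (letter c) = phi Delta c.
Proof. by rewrite Phi_cons Phi_nil prod2_unitr. Qed.

Definition Phi_op : local_op T 1 2 := op12 Phi.
Local Notation G := Phi_op.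
Local Notation g k := (at_ k G).

Lemma degree_head n u x : p n 0 (letter (word u) ** x) = letter (proj n (word u)) ** x.
Proof. by rewrite at0_cat ?op11E //; exact: hom_letter. Qed.

Lemma Phi_head u x : g 0 (letter u ** x) = word2 (Phi u) ** x.
Proof. by rewrite at0_cat ?op12E //; exact: hom_letter. Qed.

Lemma concat_head u v x : m 0 (letter u ** (letter v ** x)) = letter (u ** v) ** x.
Proof. by rewrite catTA -word2_pure at0_cat ?op21E //; exact: hom_word2. Qed.

Lemma hom_empty : hom 0 (word ([::] : seq T)).
Proof. exact: hom_word. Qed.

(** The recursion defining [Phi], as a relation between operators: [p 1 k]
    restricts the first factor of the product to letters. *)
Lemma Phi_concat_letter k t :
  g k (m k (p 1 k t)) = m k.+1 (m k (b k.+1 (f k (g k.+1 (p 1 k t))))).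
Proof.
have H : g 0 \o m 0 \o p 1 0 =1 m 1 \o m 0 \o b 1 \o f 0 \o g 1 \o p 1 0.
  apply: word_tuple_ext => -[|u us] /=.
    by rewrite (at_short _ hom_empty) // !at_zero.
  rewrite word_cons degree_head projE; case: eqP => [|_]; last first.
    by rewrite linear0 cat0T !at_zero.
  case: u => [|c [|//]] // _; case: us => [|v us] /=.
    have h1 : hom 1 (letter (word [:: c]) ** word [::]) by rewrite catT1; exact: hom_letter.
    by rewrite (at_short M h1) // (at_short G h1) // !at_zero.
  rewrite [word (_ :: map _ _)]word_cons concat_head (cat_word [:: c] v) Phi_head Phi_cons.
  rewrite (at_shift_cat (k := 1) 0); last exact: hom_letter.
  rewrite Phi_head phi_head phi_extE catTA.
  by rewrite braided_product_diagram.
shift_relation H k t.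
Qed.

Definition split_op : local_op T 1 2 := op12 (@deconcat K C 1).

(** A word of length [n.+1] is the product of a letter and a word of length [n].
    In this form the induction on words becomes an induction on the degree of a
    letter of [T(T(C))], and the induction hypothesis is available at every
    position. *)
Lemma degree_peel n k t :
  p n.+1 k t = m k (p 1 k (p n k.+1 (at_ k split_op t))).
Proof.
have H : p n.+1 0 =1 m 0 \o p 1 0 \o p n 1 \o at_ 0 split_op.
  apply: word_tuple_ext => -[|u us] /=.
    by rewrite !(at_short _ hom_empty) // !at_zero.
  rewrite word_cons degree_head at0_cat ?op12E; last exact: hom_letter.
  rewrite /= deconcatE word2_pure -catTA.
  rewrite (at_shift_cat (k := 1) 0); last exact: hom_letter.
  rewrite !degree_head concat_head !projE; case: u => [|c u] /=.
    by rewrite cat0T linear0 cat0T.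
  rewrite take0 drop0 eqSS; case: eqP => _; first by rewrite (cat_word [:: c] u).
  by rewrite catT0 linear0 cat0T.
shift_relation H k t.
Qed.

Lemma degree_ext (W : lmodType K) k (X Y : {linear TT -> W}) :
    (forall n t, hom n t -> (n < k.+1)%N -> X t = Y t) ->
    (forall n t, X (p n k t) = Y (p n k t)) ->
  X =1 Y.
Proof.
move=> XY0 XY; apply: word_tuple_ext => us; case: (ltnP (size us) k.+1) => ltk.
  by apply: (XY0 (size us)) => //; apply: hom_word; rewrite size_map.
suff e : p (size (nth [::] us k)) k (word (map (@word K C) us)) =
    word (map (@word K C) us) by rewrite -e; exact: XY.
rewrite -{2 3}(cat_take_drop k us) (drop_nth [::] ltk) map_cat -cat_word map_cons word_cons.
rewrite -[k in at_ k]addn0 at_shift_cat; last first.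
  by apply: hom_word; rewrite size_map size_takel // ltnW.
by rewrite degree_head projE eqxx -word_cons -map_cons cat_word -map_cat -drop_nth ?cat_take_drop.
Qed.

End PhiMap.

(** * Compatibility with the braiding, multiplicativity, coassociativity *)

Section PhiTheory.
Variables (K : fieldType) (C : lmodType K).
Variables (Delta : {linear C -> C ⊗ C}) (sigma : {linear C ⊗ C -> C ⊗ C}).
Local Notation T := (tensor_algebra C).
Local Notation TT := (tensor_algebra T).
Local Notation s_ k := (at_ k (op22 sigma)).
Local Notation d_ k := (at_ k (op12 Delta)).
Local Notation B := (beta_op sigma).
Local Notation M := (concat_op C).
Local Notation F := (phi_op Delta).
Local Notation G := (Phi_op Delta sigma).
Local Notation P n := (degree_op C n).
Local Notation E := (counit_op C).
Local Notation b k := (at_ k B).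
Local Notation m k := (at_ k M).
Local Notation f k := (at_ k F).
Local Notation g k := (at_ k G).
Local Notation p n k := (at_ k (P n)).
Local Notation e k := (at_ k E).
Implicit Types (t : TT).

Hypothesis sigma_braid :
  forall k x, s_ k (s_ k.+1 (s_ k x)) = s_ k.+1 (s_ k (s_ k.+1 x)).
Hypothesis dup_l : forall k x, d_ k.+1 (s_ k x) = s_ k (s_ k.+1 (d_ k x)).
Hypothesis dup_r : forall k x, d_ k (s_ k x) = s_ k.+1 (s_ k (d_ k.+1 x)).
Hypothesis dup_coassoc : forall k x, d_ k (d_ k x) = d_ k.+1 (d_ k x).

Let rec := Phi_concat_letter Delta sigma.

Lemma Phi_unit0 ns x : g 0 (cut (0 :: ns)%N x) = cut [:: 0, 0 & ns]%N x.
Proof. by apply: dup0_unit; exact: Phi_nil. Qed.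

Lemma Phi_unit1 l ns x : g 1 (cut [:: l, 0 & ns]%N x) = cut [:: l, 0, 0 & ns]%N x.
Proof.
by rewrite cut_block at_cons_block; apply: eq_cons_block => u; exact: Phi_unit0.
Qed.

Lemma Phi_letter0 ns x : g 0 (cut (1 :: ns)%N x) = f 0 (cut (1 :: ns)%N x).
Proof.
apply: (cut_head (Z := g 0) (Z' := f 0 \o cut (1 :: ns)%N)) => [j y hy lty|[|c []] // y _].
  by rewrite /= (cut_head_short _ hy) // at_zero.
rewrite [LHS]/= [RHS]/= cut_cat; last exact: hom_word.
by rewrite Phi_head phi_head phi_extE (Phi_letter Delta sigma c).
Qed.

Lemma Phi_letter1 l ns x : g 1 (cut [:: l, 1 & ns]%N x) = f 1 (cut [:: l, 1 & ns]%N x).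
Proof.
by rewrite cut_block !at_cons_block; apply: eq_cons_block => u; exact: Phi_letter0.
Qed.

(** The values of [phi] have letters and units as tensor factors, on which [Phi]
    and [phi] coincide. *)
Lemma Phi_phi0 k t : g k (f k t) = f k (f k t).
Proof.
have H : g 0 \o f 0 =1 f 0 \o f 0.
  apply: cut_ext => -[|[|[|n]] ns] u /=.
  - by rewrite !at_cut_short ?at_zero.
  - by rewrite phi0_cut0 Phi_unit0 phi0_cut0.
  - by rewrite phi0_cut1 !at_add !Phi_unit0 !Phi_letter0 !phi0_cut0.
  - by rewrite phi0_cut2 !at_zero.
shift_relation H k t.
Qed.

Lemma Phi_phi1 k t : g k.+1 (f k t) = f k.+1 (f k t).
Proof.
have H : g 1 \o f 0 =1 f 1 \o f 0.
  apply: cut_ext => -[|[|[|n]] ns] u /=.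
  - by rewrite !at_cut_short ?at_zero.
  - by rewrite phi0_cut0 Phi_unit1 phi1_cut0.
  - by rewrite phi0_cut1 !at_add !Phi_unit1 !Phi_letter1 !phi1_cut0.
  - by rewrite phi0_cut2 !at_zero.
shift_relation H k t.
Qed.

Lemma degreeC n n' k t : p n k (p n' k.+1 t) = p n' k.+1 (p n k t).
Proof. by apply: at_comm; lia. Qed.

(** Induction on the degree of the factor that [Phi] splits. For a product of a
    letter and a word, the braiding first passes over both of them, the
    recursion for [Phi] applies, and [slide_left] or [slide_right] moves the
    multiplication by [phi c] back past the braiding. *)
Lemma Phi_beta_l_degree n k t : g k.+1 (b k (p n k t)) = b k (b k.+1 (g k (p n k t))).
Proof.
elim: n k t => [|n IH] k t.
  have H : g 1 \o b 0 \o p 0 0 =1 b 0 \o b 1 \o g 0 \o p 0 0.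
    apply: cut_ext => -[|i [|j ns]] u /=.
    - by rewrite !at_cut_short ?at_zero.
    - rewrite degree0_cut; case: eqP => [->|_]; last by rewrite !at_zero.
      by rewrite Phi_unit0 (at_cut_short B) // (at_cut_short (k := 1)) // !at_zero.
    - rewrite degree0_cut; case: eqP => [->|_]; last by rewrite !at_zero.
      by rewrite Phi_unit0 !(beta0_cut, beta1_cut) Phi_unit1.
  shift_relation H k t.
have H : g 1 \o b 0 \o p n.+1 0 =1 b 0 \o b 1 \o g 0 \o p n.+1 0.
  move=> {}t; rewrite [LHS]/= [RHS]/= degree_peel.
  set s := at_ 0 (split_op C) t.
  rewrite rec beta_concat_l -(at_comm (P 1) B 0 1 1) // beta_degree_l rec.
  rewrite -beta_degree_l (at_comm (P 1) B 0 1 1) // -(at_comm B G 0 2 2) //.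
  by rewrite degreeC IH slide_left.
shift_relation H k t.
Qed.

Lemma Phi_beta_r_degree n k t :
  g k (b k (p n k.+1 t)) = b k.+1 (b k (g k.+1 (p n k.+1 t))).
Proof.
elim: n k t => [|n IH] k t.
  have H : g 0 \o b 0 \o p 0 1 =1 b 1 \o b 0 \o g 1 \o p 0 1.
    apply: cut_ext => -[|i [|j ns]] u /=.
    - by rewrite !at_cut_short ?at_zero.
    - by rewrite !at_cut_short ?at_zero.
    - rewrite degree1_cut; case: eqP => [->|_]; last by rewrite !at_zero.
      by rewrite Phi_unit1 !(beta0_cut, beta1_cut) Phi_unit0 crossing0.
  shift_relation H k t.
have H : g 0 \o b 0 \o p n.+1 1 =1 b 1 \o b 0 \o g 1 \o p n.+1 1.
  move=> {}t; rewrite [LHS]/= [RHS]/= degree_peel.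
  set s := at_ 1 (split_op C) t.
  rewrite rec beta_concat_r beta_degree_r -(at_comm (P 1) B 0 1 1) // rec.
  rewrite (at_comm (P 1) B 0 1 1) // -beta_degree_r degreeC (at_comm B (P n) 0 2 2) //.
  by rewrite IH -(at_comm B (P n) 0 2 2) // -(at_comm B G 0 2 2) // slide_right.
shift_relation H k t.
Qed.

Lemma Phi_beta_l k t : g k.+1 (b k t) = b k (b k.+1 (g k t)).
Proof.
have H : g 1 \o b 0 =1 b 0 \o b 1 \o g 0.
  apply: (degree_ext (k := 0)) => [n x hx ltn|n x] /=; last exact: Phi_beta_l_degree.
  by rewrite (at_short B hx) ?(at_short G hx) ?at_zero //; lia.
shift_relation H k t.
Qed.

Lemma Phi_beta_r k t : g k (b k t) = b k.+1 (b k (g k.+1 t)).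
Proof.
have H : g 0 \o b 0 =1 b 1 \o b 0 \o g 1.
  apply: (degree_ext (k := 1)) => [n x hx ltn|n x] /=; last exact: Phi_beta_r_degree.
  by rewrite (at_short B hx) ?(at_short G hx) ?at_zero //; lia.
shift_relation H k t.
Qed.

Lemma Phi_concat k t : g k (m k t) = m k.+1 (m k (b k.+1 (g k (g k.+1 t)))).
Proof.
have HP n j x : g j (m j (p n j x)) = m j.+1 (m j (b j.+1 (g j (g j.+1 (p n j x))))).
  elim: n j x => [|n IH] j x.
    have H : g 0 \o m 0 \o p 0 0 =1 m 1 \o m 0 \o b 1 \o g 0 \o g 1 \o p 0 0.
      apply: word_tuple_ext => -[|u us].
        by rewrite [LHS]/= [RHS]/= !(at_short _ (hom_empty _)) // !at_zero.
      rewrite [LHS]/= [RHS]/= word_cons degree_head projE; case: eqP => [/size0nil->|_]; last first.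
        by rewrite linear0 cat0T !at_zero.
      case: us => [|v us] /=.
        have h1 : hom 1 (letter (word ([::] : seq C)) ** word [::]).
          by rewrite catT1; exact: hom_letter.
        by rewrite (at_short M h1) // (at_short (k := 1) G h1) // !at_zero.
      rewrite [word (_ :: map _ _)]word_cons concat_head cat1T Phi_head.
      rewrite (at_shift_cat (k := 1) 0); last exact: hom_letter.
      by rewrite !Phi_head Phi_nil catTA braided_product_diagram prod2_unitl.
    shift_relation H j x.
  have H : g 0 \o m 0 \o p n.+1 0 =1 m 1 \o m 0 \o b 1 \o g 0 \o g 1 \o p n.+1 0.
    move=> {}x; rewrite [LHS]/= [RHS]/= degree_peel.
    set s := at_ 0 (split_op C) x.
    rewrite -concat_assoc -(at_comm (P 1) M 0 1 1) // rec (at_comm (P 1) M 0 1 1) // degreeC IH.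
    rewrite -(at_comm M G 0 2 1) // -degreeC -(at_comm (P 1) G 0 2 2) // rec (at_comm (P 1) G 0 2 2) //.
    by rewrite product_assoc (at_comm F G 0 1 2).
  shift_relation H j x.
have H : g 0 \o m 0 =1 m 1 \o m 0 \o b 1 \o g 0 \o g 1.
  apply: (degree_ext (k := 0)) => [n x hx ltn|n x] /=; last exact: HP.
  by rewrite (at_short M hx) ?(at_short (k := 1) G hx) ?at_zero //; lia.
shift_relation H k t.
Qed.

(** For a product of a letter [c] and a word, both iterates of [Phi] are computed
    as the product of the iterate on [c], which is an iterate of [phi], and of
    the iterate on the word: on one side by [Phi_beta_r], on the other by
    [Phi_beta_l]. *)
Lemma Phi_coassoc k t : g k (g k t) = g k.+1 (g k t).
Proof.
have HP n j x : g j (g j (p n j x)) = g j.+1 (g j (p n j x)).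
  elim: n j x => [|n IH] j x.
    have H : g 0 \o g 0 \o p 0 0 =1 g 1 \o g 0 \o p 0 0.
      apply: cut_ext => -[|i ns] u /=.
      - by rewrite !at_cut_short ?at_zero.
      - rewrite degree0_cut; case: eqP => [->|_]; last by rewrite !at_zero.
        by rewrite !(Phi_unit0, Phi_unit1).
    shift_relation H j x.
  have H : g 0 \o g 0 \o p n.+1 0 =1 g 1 \o g 0 \o p n.+1 0.
    move=> {}x; rewrite [LHS]/= [RHS]/= degree_peel.
    set s := at_ 0 (split_op C) x.
    rewrite rec degreeC; set y := g 1 _.
    have -> : g 0 (m 1 (m 0 (b 1 (f 0 y)))) =
        m 2 (m 1 (m 0 (b 1 (b 3 (b 2 (f 0 (f 0 (g 1 y)))))))).
      rewrite (at_comm G M 0 1 2) // Phi_concat Phi_beta_r (at_comm G B 0 2 3) // (at_comm G B 0 1 2) //.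
      by rewrite -(at_comm F G 0 1 2) // Phi_phi0.
    rewrite {1}/y IH -/y.
    rewrite Phi_concat -(at_comm M G 0 3 2) // -(at_comm M G 0 2 1) // -(at_comm M B 0 3 2) //.
    rewrite -(at_comm B G 1 3 3) // Phi_beta_l -(at_comm F G 0 2 3) // Phi_phi1 -phi_coassoc //.
    by rewrite (at_comm B B 1 3 3).
  shift_relation H j x.
have H : g 0 \o g 0 =1 g 1 \o g 0.
  apply: (degree_ext (k := 0)) => [n x hx ltn|n x] /=; last exact: HP.
  by rewrite (at_short G hx) ?at_zero //; lia.
shift_relation H k t.
Qed.

(** The augmentation is multiplicative and ignores the braiding, and on letters
    only the term [1 (x) c], or [c (x) 1] for [counit_Phi_r], survives. *)
Lemma counit_Phi_l x : e 0 (g 0 (letter x)) = letter x.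
Proof.
have HP n k y : e k (g k (p n k y)) = p n k y.
  elim: n k y => [|n IH] k y.
    have H : e 0 \o g 0 \o p 0 0 =1 p 0 0.
      apply: cut_ext => -[|i ns] u /=; first by rewrite !at_cut_short ?at_zero.
      rewrite degree0_cut; case: eqP => [->|_]; last by rewrite !at_zero.
      by rewrite Phi_unit0 counit0_cut.
    shift_relation H k y.
  have H : e 0 \o g 0 \o p n.+1 0 =1 p n.+1 0.
    move=> {}y; rewrite [LHS]/= [RHS]/= degree_peel.
    set s := at_ 0 (split_op C) y.
    rewrite rec (at_comm E M 0 1 0) // counit_concat -(at_comm E E 0 1 0) // counit_beta_l.
    by rewrite -(at_comm F E 0 1 2) // degreeC IH -degreeC counit_phi_l.
  shift_relation H k y.
apply: (word_ext (f := e 0 \o g 0 \o @letter K T) (h := @letter K T)) => u /=.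
have := HP (size u) 0 (letter (word u)); rewrite -[letter _]catT1 degree_head.
by rewrite projE eqxx.
Qed.

Lemma counit_Phi_r x : e 1 (g 0 (letter x)) = letter x.
Proof.
have HP n k y : e k.+1 (g k (p n k y)) = p n k y.
  elim: n k y => [|n IH] k y.
    have H : e 1 \o g 0 \o p 0 0 =1 p 0 0.
      apply: cut_ext => -[|i ns] u /=; first by rewrite !at_cut_short ?at_zero.
      rewrite degree0_cut; case: eqP => [->|_]; last by rewrite !at_zero.
      by rewrite Phi_unit0 counit1_cut.
    shift_relation H k y.
  have H : e 1 \o g 0 \o p n.+1 0 =1 p n.+1 0.
    move=> {}y; rewrite [LHS]/= [RHS]/= degree_peel.
    set s := at_ 0 (split_op C) y.
    rewrite rec counit_concat -(at_comm M E 0 2 1) // -(at_comm M E 0 2 1) //.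
    rewrite -(at_comm E E 2 3 2) // -(at_comm B E 1 3 3) // concat_counit_beta.
    by rewrite -(at_comm F E 0 2 3) // degreeC IH -degreeC counit_phi_r.
  shift_relation H k y.
apply: (word_ext (f := e 1 \o g 0 \o @letter K T) (h := @letter K T)) => u /=.
have := HP (size u) 0 (letter (word u)); rewrite -[letter _]catT1 degree_head.
by rewrite projE eqxx.
Qed.

End PhiTheory.

(** * The inverse braiding *)

Section Inverse.
Variables (K : fieldType) (C : lmodType K).
Variables (sigma sigma' : {linear C ⊗ C -> C ⊗ C}).
Local Notation T := (tensor_algebra C).

Lemma braid_along_rev n ks (t : T) : cancel sigma sigma' ->
    (forall k, k \in ks -> (k.+1 < n)%N) -> hom n t ->
  braid_along sigma' (rev ks) (braid_along sigma ks t) = t.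
Proof.
move=> sK ltks ht; elim: ks ltks => //= k ks IH ltks.
rewrite rev_cons -cats1 braid_along_cat /=.
rewrite (at22_inv sK (braid_along_hom sigma ks ht)) ?IH //.
  by move=> l lks; apply: ltks; rewrite inE lks orbT.
by apply: ltks; rewrite mem_head.
Qed.

(** The reverse of [crossing i j] is a word of minimal length for [chi j i], so
    that [beta] for the inverse of [sigma] undoes the crossings one by one. *)
Lemma beta_cancel : cancel sigma sigma' -> cancel (beta sigma) (beta sigma').
Proof.
move=> sK.
suff H : beta sigma' \o beta sigma =1 @idfun (T ⊗ T) by exact: H.
apply: word2_ext => u v; rewrite [LHS]/= [RHS]/=; apply: (can_inj (@word2K K T)).
have e : word2 (word u \ox word v) = cut [:: size u; size v] (word u ** word v).
  by rewrite word2E cat_word; have := word_cut [:: u; v]; rewrite /= cats0.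
have b0 (S : {linear C ⊗ C -> C ⊗ C}) s : word2 (beta S s) = at_ 0 (beta_op S) (word2 s).
  by rewrite at0_word2.
rewrite !b0 e !beta0_cut; congr (cut _ _).
set i := size u; set j := size v.
have ht : hom (i + j) (word u ** word v) by apply: hom_cat; exact: hom_word.
rewrite -(@braid_along_sorts _ _ sigma' j i (rev (crossing i j))).
  exact: (braid_along_rev sK (@crossing_lt i j) ht).
apply: sorts_crossing => [k|r ltr|].
- by rewrite mem_rev addnC => /crossing_lt.
- have lt' : ((if (r < j)%N then i + r else r - j) < i + j)%N by case: ifP; lia.
  have {1}-> : r = foldr adj_swap (if (r < j)%N then i + r else r - j)%N (crossing i j).
    by rewrite foldr_swap_crossing //; case: (ltnP r j) => ltrj; case: ifP => ?; lia.
  by rewrite foldr_swap_rev.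
- by rewrite size_rev size_crossing mulnC.
Qed.

End Inverse.

(** * Tensor products with the field *)

Section Scalars.
Variables (K : fieldType) (V : lmodType K).
Local Notation T := (tensor_algebra V).

Definition scalel : K^o ⊗ V -> V := tensor_lift (fun (k : K^o) x => (k : K) *: x).
HB.instance Definition _ := GRing.Linear.on scalel.

Lemma scalelE (k : K) x : scalel ((k : K^o) \ox x) = k *: x.
Proof.
rewrite /scalel tensor_liftE //; split=> [y a k1 k2|k1 a y y'] /=.
  by rewrite scalerDl scalerA.
by rewrite scalerDr !scalerA mulrC.
Qed.

Definition scaler : V ⊗ K^o -> V := tensor_lift (fun x (k : K^o) => (k : K) *: x).
HB.instance Definition _ := GRing.Linear.on scaler.

Lemma scalerE x (k : K) : scaler (x \ox (k : K^o)) = k *: x.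
Proof.
rewrite /scaler tensor_liftE //; split=> [k1 a y y'|y a k1 k2] /=.
  by rewrite scalerDr !scalerA mulrC.
by rewrite scalerDl scalerA.
Qed.

Lemma pure_scale_l (k : K) (x : V) : (1 : K^o) \ox (k *: x) = (k : K^o) \ox x.
Proof.
have e : k *: (1 : K^o) = k by exact: mulr1.
rewrite -[in RHS]e; transitivity (k *: ((1 : K^o) \ox x)); first exact: linearZ_LR.
by apply/esym; exact: (linearZ_LR (purer x : {linear K^o -> K^o ⊗ V})).
Qed.

Lemma pure_scale_r (k : K) (x : V) : (k *: x) \ox (1 : K^o) = x \ox (k : K^o).
Proof.
have e : k *: (1 : K^o) = k by exact: mulr1.
rewrite -[in RHS]e; transitivity (k *: (x \ox (1 : K^o))); last by apply/esym; exact: linearZ_LR.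
exact: (linearZ_LR (purer (1 : K^o) : {linear V -> V ⊗ K^o})).
Qed.

Lemma scalelK s : (1 : K^o) \ox scalel s = s.
Proof.
apply: (tensor_ext (f := pure (1 : K^o) \o scalel) (h := @idfun (K^o ⊗ V))) => k x.
by rewrite [LHS]/= [RHS]/= scalelE pure_scale_l.
Qed.

Lemma scalerK s : scaler s \ox (1 : K^o) = s.
Proof.
apply: (tensor_ext (f := purer (1 : K^o) \o scaler) (h := @idfun (V ⊗ K^o))) => x k.
by rewrite [LHS]/= [RHS]/= /purer scalerE pure_scale_r.
Qed.

Variable eps : {linear V -> K^o}.

Lemma at0_counit s : at_ 0 (op10 eps) (word2 s) = letter (scalel (tensor_map eps idfun s)).
Proof.
apply: (tensor_ext (f := at_ 0 (op10 eps) \o @word2 K V)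
  (h := @letter K V \o scalel \o tensor_map eps idfun)) => x y.
rewrite [LHS]/= [RHS]/= tensor_mapE scalelE word2_pure.
rewrite at0_cat ?op10E; last exact: hom_letter.
transitivity ((eps x : K) *: letter y); last by apply/esym; exact: linearZ_LR.
rewrite -[in RHS](cat1T (letter y)).
exact: (linearZ_LR (@concat K V \o purer (letter y))).
Qed.

Lemma at1_counit s : at_ 1 (op10 eps) (word2 s) = letter (scaler (tensor_map idfun eps s)).
Proof.
apply: (tensor_ext (f := at_ 1 (op10 eps) \o @word2 K V)
  (h := @letter K V \o scaler \o tensor_map idfun eps)) => x y.
rewrite [LHS]/= [RHS]/= tensor_mapE scalerE word2_pure.
rewrite (at_shift_cat (k := 1)); last exact: hom_letter.
rewrite -[letter y]catT1 at0_cat ?op10E; last exact: hom_letter.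
transitivity ((eps y : K) *: letter x); last by apply/esym; exact: linearZ_LR.
rewrite catT1 -[in RHS](catT1 (letter x)).
exact: (linearZ_LR (@concat K V \o pure (letter x))).
Qed.

End Scalars.

(** * Conclusion *)

Theorem proposition6p4 (K : fieldType) (charK : [pchar K] =i pred0)
    (C : lmodType K) (Delta : {linear C -> C ⊗ C})
    (sigma : {linear C ⊗ C -> C ⊗ C}) :
  braided_coalgebra Delta sigma ->
  exists Phi : {linear tensor_algebra C ->
                       tensor_algebra C ⊗ tensor_algebra C},
    [/\ algebra_map_extending_phi Delta sigma Phi,
        forall Psi : {linear tensor_algebra C ->
                             tensor_algebra C ⊗ tensor_algebra C},
          algebra_map_extending_phi Delta sigma Psi -> Psi =1 Phi
      & braided_coalgebra Phi (beta sigma)].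
Proof.
case=> -[eps [coassoc _ _]] [[sigma' sK sK'] braid] dupl dupr.
move/braid_relP: braid => braid; move/dup_braid_lP: dupl => dupl.
move/dup_braid_rP: dupr => dupr; move/dup_coassocP: coassoc => coassoc.
have lin' : linear sigma'.
  by move=> a s t; apply: (can_inj sK); rewrite linearP !sK'.
pose sigmaV : {linear C ⊗ C -> C ⊗ C} :=
  HB.pack sigma' (GRing.isLinear.Build _ _ _ _ sigma' lin').
exists (Phi Delta sigma); split.
- split; last exact: Phi_letter.
  split; first exact: Phi_nil.
  apply: (tensor_ext (f := Phi Delta sigma \o @concat K C)
    (h := braided_product (@concat K C) (beta sigma)
            \o tensor_map (Phi Delta sigma) (Phi Delta sigma))) => x y.
  rewrite [LHS]/= [RHS]/= tensor_mapE.
  apply: (can_inj (@word2K K (tensor_algebra C))).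
  have := Phi_concat Delta sigma 0 (letter x ** (letter y ** word [::])).
  rewrite concat_head (at_shift_cat (k := 1) 0); last exact: hom_letter.
  by rewrite !Phi_head catTA braided_product_diagram !catT1.
- move=> Psi [[Psi1 PsiM] PsiL]; apply: word_ext => u /=.
  elim: u => [|c u IH]; first by rewrite Psi1 Phi_nil.
  rewrite Phi_cons -IH -PsiL -[c :: u]cat1s -cat_word PsiM.
  by rewrite tensor_mapE.
split.
- exists (@augmentation K C); split.
  + by apply/dup_coassocP => k t; exact: (Phi_coassoc braid dupl dupr coassoc).
  + move=> x; rewrite -[LHS]scalelK; congr (_ \ox _).
    apply: (can_inj (@letterK K _)); rewrite -at0_counit.
    by rewrite -[RHS](counit_Phi_l Delta sigma) at0_letter.
  + move=> x; rewrite -[LHS]scalerK; congr (_ \ox _).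
    apply: (can_inj (@letterK K _)); rewrite -at1_counit.
    by rewrite -[RHS](counit_Phi_r Delta sigma) at0_letter.
- split; last by apply/braid_relP => k t; exact: beta_braid.
  by exists (beta sigmaV); apply: beta_cancel.
- by apply/dup_braid_lP => k t; exact: (Phi_beta_l braid dupl).
- by apply/dup_braid_rP => k t; exact: (Phi_beta_r braid dupr).
Qed.
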